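(* Let $\rho>0$, and let $\rho_c\in(0,+\infty]$ and $\rho_*$ be the thresholds $$\rho_c=\lim_{\kappa\to0}\frac{j(\kappa)}{c(\kappa)}=\lim_{r\to0}\frac{r}{c(k(r))}=\lim_{r\to0}\frac{n\,r}{k(r)},\qquad \rho_*=\inf_{\kappa\in(0,\kappa_{max})}\frac{j(\kappa)}{c(\kappa)}=\inf_{r>0}\frac{r}{c(k(r))}.$$ Then $\rho_c\ge\rho_*$, and: (i) If $\rho<\rho_*$, the only solution of the compatibility equation $j(\kappa)=\rho\,c(\kappa)$ is $\kappa=0$, and the only equilibrium with total mass $\rho$ is the uniform distribution $f=\rho$. (ii) If $\rho>\rho_*$, there exists at least one positive solution $\kappa>0$ of the compatibility equation $j(\kappa)=\rho\,c(\kappa)$; it corresponds to a family $\{\rho M_{\kappa\Omega},\ \Omega\in\mathbb S\}$ of non-isotropic equilibria. (iii) The number of families of non-isotropic equilibria changes as $\rho$ crosses $\rho_c$, in the following sense: suppose $\rho_c<\infty$, $\kappa\mapsto\frac{j(\kappa)}{c(\kappa)}$ is differentiable, and for some $\varepsilon>0$, for all $\rho\in(\rho_c-\varepsilon,\rho_c)\cup(\rho_c,\rho_c+\varepsilon)$, all positive solutions $\kappa$ of the compatibility equation satisfy $\left(\frac jc\right)'(\kappa)\ne0$. Then the number of positive solutions $\kappa$ of the compatibility equation (that is, of families of non-isotropic equilibria), if finite, is even for $\rho\in(\rho_c-\varepsilon,\rho_c)$ and odd for $\rho\in(\rho_c,\rho_c+\varepsilon)$.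
   Context: Let $n\ge 2$ and let $\mathbb S$ be the unit sphere of $\mathbb R^n$ with the uniform probability measure $d\omega$; $P_{\omega^\perp}=\mathrm{Id}-\omega\otimes\omega$. The functions $\nu:[0,\infty)\to[0,\infty)$ and $\tau:[0,\infty)\to(0,\infty)$ are such that $r\mapsto\nu(r)/r$ and $r\mapsto\tau(r)$ are Lipschitz and bounded; $\tau_0=\tau(0)>0$. The function $k(r)=\nu(r)/\tau(r)$ is increasing; $\kappa_{max}=\lim_{r\to\infty}k(r)\in(0,\infty]$ and $j:[0,\kappa_{max})\to[0,\infty)$ is the inverse function of $k$. $M_{\kappa\Omega}(\omega)=e^{\kappa\,\omega\cdot\Omega}/\int_{\mathbb S}e^{\kappa\,\upsilon\cdot\Omega}d\upsilon$ for $\kappa\ge0$, $\Omega\in\mathbb S$, and $c(\kappa)=\frac{\int_0^\pi\cos\theta\,e^{\kappa\cos\theta}\sin^{n-2}\theta\,d\theta}{\int_0^\pi e^{\kappa\cos\theta}\sin^{n-2}\theta\,d\theta}$, an increasing bijection from $[0,\infty)$ onto $[0,1)$. An equilibrium is a nonnegative function $f\in C^2(\mathbb S)$ with $Q(f)=0$, where $J_f=\int_{\mathbb S}\omega f\,d\omega$, $\Omega_f=J_f/|J_f|$ and $Q(f)=-\nu(|J_f|)\nabla_\omega\cdot(P_{\omega^\perp}\Omega_f\,f)+\tau(|J_f|)\Delta_\omega f$ (with $Q(f)=\tau_0\Delta_\omega f$ if $J_f=0$). Its total mass is $\int_{\mathbb S} f\,d\omega$. The equilibria of mass $\rho$ are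 exactly the functions $\rho M_{\kappa\Omega}$ with $\Omega\in\mathbb S$ and $j(\kappa)=\rho\,c(\kappa)$. *)

(* Defs.v *)
From HB Require Import structures.
From mathcomp Require Import all_boot all_order all_algebra.
From mathcomp Require Import all_classical all_reals all_analysis.

Set Implicit Arguments.
Unset Strict Implicit.
Unset Printing Implicit Defensive.

Import Order.TTheory GRing.Theory Num.Theory.
Import numFieldNormedType.Exports.

Local Open Scope classical_set_scope.
Local Open Scope ring_scope.

(* The norm `|x| that the library puts on 'rV[R]_n is the sup norm (it induces
   the usual topology); the Euclidean structure is therefore explicit. *)
Definition dotp (R : realType) (n : nat) (x y : 'rV[R]_n) : R :=
  \sum_(i < n) x 0 i * y 0 i.

Definition enorm (R : realType) (n : nat) (x : 'rV[R]_n) : R :=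
  Num.sqrt (dotp x x).

Definition usphere (R : realType) (n : nat) : set 'rV[R]_n :=
  [set x | enorm x = 1].

(* R^n with its Borel sigma-algebra. *)
Definition borelRV (R : realType) (n : nat) :=
  g_sigma_algebraType (@open 'rV[R]_n).

(* The uniform probability measure of the sphere, seen as a Borel measure on
   R^n: the (unique) probability carried by the sphere which is invariant under
   the orthogonal group. *)
Definition uniform_on_sphere (R : realType) (n : nat)
    (mu : probability (borelRV R n) R) : Prop :=
  mu (@usphere R n) = 1%E /\
  forall U : 'M[R]_n, U *m U^T = 1%:M ->
  forall A : set (borelRV R n), measurable A ->
    mu [set x : 'rV[R]_n | A (x *m U)] = mu A.

(* Functions and fields on the sphere are represented by functions on R^n of
   which only the values on the sphere matter. Their differential calculus is
   that of the extension to R^n \ {0} that is constant along rays. *)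
Definition radial_ext (R : realType) (n : nat) (T : Type) (f : 'rV[R]_n -> T)
    : 'rV[R]_n -> T :=
  fun x => f ((enorm x)^-1 *: x).

Definition partial (R : realType) (n : nat) (i : 'I_n) (g : 'rV[R]_n -> R)
    : 'rV[R]_n -> R :=
  fun x => 'D_(delta_mx 0 i) g x.

Definition C2_on (R : realType) (n : nat) (D : set 'rV[R]_n)
    (g : 'rV[R]_n -> R) : Prop :=
  [/\ forall x, D x -> {for x, continuous g},
      forall i x, D x ->
        derivable g x (delta_mx 0 i) /\ {for x, continuous (partial i g)} &
      forall i j x, D x ->
        derivable (partial j g) x (delta_mx 0 i) /\
        {for x, continuous (partial i (partial j g))}].

Definition C2_sphere (R : realType) (n : nat) (f : 'rV[R]_n -> R) : Prop :=
  C2_on [set x | x != 0] (radial_ext f).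

(* Since the extension is constant along rays, on the sphere its Euclidean
   Laplacian is the Laplace-Beltrami operator, and the Euclidean divergence of
   an extended tangent field is the divergence on the sphere. *)
Definition sphere_lap (R : realType) (n : nat) (f : 'rV[R]_n -> R)
    (w : 'rV[R]_n) : R :=
  \sum_(i < n) partial i (partial i (radial_ext f)) w.

Definition sphere_div (R : realType) (n : nat) (A : 'rV[R]_n -> 'rV[R]_n)
    (w : 'rV[R]_n) : R :=
  \sum_(i < n) partial i (fun x => radial_ext A x 0 i) w.

(* Id - w (x) w, a symmetric matrix acting on row vectors from the right. *)
Definition Pperp (R : realType) (n : nat) (w : 'rV[R]_n) : 'M[R]_n :=
  1%:M - w^T *m w.

Definition mass (R : realType) (n : nat) (mu : probability (borelRV R n) R)
    (f : 'rV[R]_n -> R) : R :=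
  \int[mu]_(w in @usphere R n) f w.

Definition flux (R : realType) (n : nat) (mu : probability (borelRV R n) R)
    (f : 'rV[R]_n -> R) : 'rV[R]_n :=
  \row_(i < n) \int[mu]_(w in @usphere R n) ((w : 'rV[R]_n) 0 i * f w).

Definition direction (R : realType) (n : nat) (x : 'rV[R]_n) : 'rV[R]_n :=
  (enorm x)^-1 *: x.

Definition Qop (R : realType) (n : nat) (mu : probability (borelRV R n) R)
    (nu tau : R -> R) (f : 'rV[R]_n -> R) (w : 'rV[R]_n) : R :=
  let J := flux mu f in
  if J == 0 then tau 0 * sphere_lap f w
  else - nu (enorm J) * sphere_div (fun v => f v *: (direction J *m Pperp v)) w
       + tau (enorm J) * sphere_lap f w.

Definition equilibrium (R : realType) (n : nat)
    (mu : probability (borelRV R n) R) (nu tau : R -> R)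
    (f : 'rV[R]_n -> R) : Prop :=
  [/\ C2_sphere f,
      forall w, usphere w -> 0 <= f w &
      forall w, usphere w -> Qop mu nu tau f w = 0].

Definition isotropic (R : realType) (n : nat) (f : 'rV[R]_n -> R) : Prop :=
  exists a : R, forall w, usphere w -> f w = a.

Definition noniso_equilibria (R : realType) (n : nat)
    (mu : probability (borelRV R n) R) (nu tau : R -> R) (rho : R)
    : set ('rV[R]_n -> R) :=
  [set f | [/\ equilibrium mu nu tau f, mass mu f = rho & ~ isotropic f]].

Definition vonMises (R : realType) (n : nat) (mu : probability (borelRV R n) R)
    (kappa : R) (Omega w : 'rV[R]_n) : R :=
  expR (kappa * dotp w Omega) /
  \int[mu]_(v in @usphere R n) expR (kappa * dotp v Omega).

(* The functions equal on the sphere to rho M_{kappa Omega} for some Omega. *)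
Definition vonMises_family (R : realType) (n : nat)
    (mu : probability (borelRV R n) R) (rho kappa : R) : set ('rV[R]_n -> R) :=
  [set f | exists Omega, usphere Omega /\
     forall w, usphere w -> f w = rho * vonMises mu kappa Omega w].

Definition noniso_families (R : realType) (n : nat)
    (mu : probability (borelRV R n) R) (nu tau : R -> R) (rho : R)
    : set (set ('rV[R]_n -> R)) :=
  [set F | exists kappa, [/\ 0 <= kappa, F = vonMises_family mu rho kappa &
     F `<=` noniso_equilibria mu nu tau rho]].

Definition order_param (R : realType) (n : nat) (kappa : R) : R :=
  (\int[lebesgue_measure]_(t in `[0, pi]%classic)
     (cos t * expR (kappa * cos t) * sin t ^+ (n - 2))) /
  (\int[lebesgue_measure]_(t in `[0, pi]%classic)
     (expR (kappa * cos t) * sin t ^+ (n - 2))).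

Definition kfun (R : realType) (nu tau : R -> R) (r : R) : R := nu r / tau r.

Definition kappa_max (R : realType) (nu tau : R -> R) : \bar R :=
  lim ((kfun nu tau r)%:E @[r --> +oo%R]).

Definition kappa_dom (R : realType) (nu tau : R -> R) : set R :=
  [set kappa | 0 <= kappa /\ (kappa%:E < kappa_max nu tau)%E].

(* The quotient nu r / r is only considered for r > 0, where Lipschitz
   continuity extends it to r = 0; the library's value 0 / 0 = 0 would be
   wrong there. That nu 0 = 0 follows from the last two conditions, as
   0 is in kappa_dom. *)
Definition admissible_coeffs (R : realType) (nu tau j : R -> R) : Prop :=
  [/\ forall r, 0 <= r -> 0 <= nu r,
      forall r, 0 <= r -> 0 < tau r,
      [lipschitz nu r / r | r in [set r : R | 0 < r]] /\
      [bounded nu r / r | r in [set r : R | 0 < r]] &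
      [lipschitz tau r | r in [set r : R | 0 <= r]] /\
      [bounded tau r | r in [set r : R | 0 <= r]]] /\
  [/\ forall r s, 0 <= r -> r < s -> kfun nu tau r < kfun nu tau s,
      forall kappa, kappa_dom nu tau kappa ->
        0 <= j kappa /\ kfun nu tau (j kappa) = kappa &
      forall r, 0 <= r -> j (kfun nu tau r) = r].

Definition solutions (R : realType) (n : nat) (nu tau j : R -> R) (rho : R)
    : set R :=
  [set kappa | kappa_dom nu tau kappa /\ j kappa = rho * order_param n kappa].

Definition pos_solutions (R : realType) (n : nat) (nu tau j : R -> R) (rho : R)
    : set R :=
  solutions n nu tau j rho `&` [set kappa | 0 < kappa].

Definition rho_c (R : realType) (n : nat) (j : R -> R) : \bar R :=
  lim ((j kappa / order_param n kappa)%:E @[kappa --> 0^'+]).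

Definition rho_star (R : realType) (n : nat) (nu tau j : R -> R) : \bar R :=
  ereal_inf [set (j kappa / order_param n kappa)%:E
            | kappa in kappa_dom nu tau `&` [set kappa | 0 < kappa]].

(* Main.v *)
Require Import Defs.
From HB Require Import structures.
From mathcomp Require Import all_boot all_order all_algebra.
From mathcomp Require Import all_classical all_reals all_analysis.
From mathcomp Require Import ring lra measurable_realfun.

Set Implicit Arguments.
Unset Strict Implicit.
Unset Printing Implicit Defensive.

Import Order.TTheory GRing.Theory Num.Theory.
Import numFieldNormedType.Exports.

Local Open Scope classical_set_scope.
Local Open Scope card_scope.
Local Open Scope ring_scope.

(* Differentiating the integrals of phi along planar rotations shows that the
   rotation generators x_i d_j - x_j d_i integrate to zero; hence so do
   divergences of tangent fields, and the moments of w.Omega obey the two-term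
   recursion of the moments of cos for the weight sin^(n-2). By an energy
   argument every equilibrium is of the form C e^(kappa w.Omega) with
   kappa = k(|J|), and comparing moments gives |J| = rho c(kappa): equilibria of
   mass rho are the rho M_(kappa Omega) with kappa = k(rho c(kappa)).
   Everything else is read off the function r / c(k(r)) on r > 0: it is
   continuous, bounded below by r because c <= 1, and has limit rho_c at 0 because
   c(kappa) ~ kappa / n. Solutions correspond to its level set rho, hence (ii) by
   the intermediate value theorem; under the assumptions of (iii) j / c - rho
   changes sign at every solution, so the parity of their number is decided by
   the sign near 0, the sign near kappa_max being positive. *)

(** * Calculus off the origin *)

Section calculus.
Context {R : realType} {n : nat}.
Implicit Types (g h : 'rV[R]_n -> R) (x y v : 'rV[R]_n).

(** The measure is known only through its invariance, so neither Stokes' theorem nor the slicing of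
    the sphere by the angle is at hand; consequences of invariance replace both. For slicing, the
    powers of w.Omega and of cos are shown to have proportional integrals, and the exponential
    series carries this over to every kappa. A vanishing energy integral must give pointwise
    vanishing, which requires the measure to have full support: this again comes from invariance,
    through compactness. Functions on the sphere are handled through extensions constant along rays.
    These are singular at the origin, hence a calculus restricted to x != 0; homogeneity passes
    between the sphere and the punctured space. The variable r = j(kappa) is preferred to kappa
    because regularity is assumed for nu and tau, so it passes to k, while j enters only as an
    inverse. The threshold rho_c is infinite exactly when k(r)/r tends to 0 at 0, so limits are
    taken in the extended reals. *)

Lemma is_derive_line (V : normedModType R) (g : V -> R) (x v : V) (a : R) :
  is_derive x v g a <-> is_derive (0 : R) (1 : R) (fun t : R => g (t *: v + x)) a.
Proof.
suff E : 'D_v g x = 'D_1 (fun t : R => g (t *: v + x)) 0.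
  split=> -[dg ga]; split.
  - by apply/(derivable1P g x v).
  - by rewrite -E.
  - by apply/(derivable1P g x v).
  - by rewrite E.
rewrite /derive; set q1 := fun t => t^-1 *: _; set q2 := fun t => t^-1 *: _.
suff -> : q1 = q2 by [].
by apply/funext => t; rewrite /q1 /q2 /= addr0 scale0r add0r [_%:A]mulr1.
Qed.

Lemma is_derive_affine (V : normedModType R) (g : V -> R) (x v : V) (t a : R) :
  is_derive (t *: v + x) v g a ->
  is_derive t (1 : R) (fun s : R => g (s *: v + x)) a.
Proof.
move=> /is_derive_line H; apply/is_derive_line; apply: is_derive_eq.
  rewrite (_ : (fun _ => _) = (fun s : R => g (s *: v + (t *: v + x)))); first exact: H.
  by apply/funext => s /=; rewrite scalerDl addrA [_%:A]mulr1.
by [].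
Qed.

Lemma is_derive_scalar_comp (f : R -> R) g x v (a b : R) :
  is_derive x v g a -> is_derive (g x) (1 : R) f b ->
  is_derive x v (fun y => f (g y)) (b * a).
Proof.
move=> /is_derive_line gx fg; apply/is_derive_line.
apply: (@is_derive1_comp _ f (fun t : R => g (t *: v + x))).
by rewrite scale0r add0r.
Qed.

(** The gradient is carried as explicit data, so that the closure rules below compute partial
    derivatives by composing terms. Continuity of the partials is included because it yields Fréchet
    differentiability, needed along curves such as rotation orbits. *)
Definition C1_grad g (dg : 'I_n -> 'rV[R]_n -> R) : Prop := forall x, x != 0 ->
  {for x, continuous g} /\
  forall i, is_derive x (delta_mx 0 i) g (dg i x) /\ {for x, continuous (dg i)}.

Lemma near_neq0 x : x != 0 -> \forall y \near x, y != 0.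
Proof.
move=> x0; have : open (~` [set (0 : 'rV[R]_n)]).
  apply: closed_openC; apply: (accessible_finite_set_closed.1 _ _ (finite_set1 _)).
  exact/hausdorff_accessible/norm_hausdorff.
rewrite openE => /(_ x) H.
have : nbhs x (~` [set (0 : 'rV[R]_n)]) by apply: H; apply/eqP.
by apply: filterS => y /eqP.
Qed.

Lemma near_eq_continuous (T U : topologicalType) (f g : T -> U) (x : T) :
  {near x, f =1 g} -> {for x, continuous f} -> {for x, continuous g}.
Proof.
move=> fg fx.
change (g @ x --> g x); rewrite -(nbhs_singleton fg : f x = g x).
by apply: cvg_trans fx; exact: near_eq_cvg.
Qed.

Lemma C1_grad_eq g h dg dh : (forall x, x != 0 -> g x = h x) ->
  (forall i x, x != 0 -> dg i x = dh i x) -> C1_grad g dg -> C1_grad h dh.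
Proof.
move=> gh dgh Cg x x0; have [cg Dg] := Cg x x0.
have ngh : {near x, g =1 h} by near=> y; apply: gh; near: y; exact: near_neq0.
split=> [|i]; first exact: near_eq_continuous cg.
have [dgi cgi] := Dg i; split.
  by rewrite -dgh//; apply: near_eq_is_derive dgi.
apply: near_eq_continuous cgi.
by near=> y; apply: dgh; near: y; exact: near_neq0.
Unshelve. all: by end_near. Qed.

Lemma C1_grad_partial g dg x i : C1_grad g dg -> x != 0 -> partial i g x = dg i x.
Proof. by move=> Cg x0; have [_ /(_ i)[/@derive_val]] := Cg x x0. Qed.

Lemma C1_grad_cst (a : R) : C1_grad (fun=> a) (fun _ _ => 0).
Proof.
move=> x _; split=> [|i]; first exact: cst_continuous.
by split; [exact: is_derive_cst|exact: cst_continuous].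
Qed.

Lemma C1_grad_coord j : C1_grad (fun x => x 0 j) (fun i _ => (i == j)%:R).
Proof.
move=> x _; split=> [|i]; first exact: coord_continuous.
split; last exact: cst_continuous.
apply/is_derive_line.
rewrite (_ : (fun _ => _) = (fun t : R => t * (i == j)%:R + x 0 j)).
  by apply: is_derive_eq; rewrite !(scaler0, addr0, add0r) [_%:A]mulr1.
by apply/funext => t; rewrite !mxE eqxx /= eq_sym.
Qed.

Lemma C1_gradD g h dg dh : C1_grad g dg -> C1_grad h dh ->
  C1_grad (fun x => g x + h x) (fun i x => dg i x + dh i x).
Proof.
move=> Cg Ch x x0; have [cg Dg] := Cg x x0; have [ch Dh] := Ch x x0.
split=> [|i]; first exact: continuousD.
have [dgi cgi] := Dg i; have [dhi chi] := Dh i.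
by split; [exact: is_deriveD|exact: continuousD].
Qed.

Lemma C1_gradM g h dg dh : C1_grad g dg -> C1_grad h dh ->
  C1_grad (fun x => g x * h x) (fun i x => g x * dh i x + h x * dg i x).
Proof.
move=> Cg Ch x x0; have [cg Dg] := Cg x x0; have [ch Dh] := Ch x x0.
split=> [|i]; first exact: continuousM.
have [dgi cgi] := Dg i; have [dhi chi] := Dh i.
split; first exact: is_deriveM.
by apply: continuousD; exact: continuousM.
Qed.

Lemma C1_gradZ (a : R) g dg : C1_grad g dg ->
  C1_grad (fun x => a * g x) (fun i x => a * dg i x).
Proof.
move=> Cg; apply: C1_grad_eq (C1_gradM (C1_grad_cst a) Cg) => // i x _.
by rewrite mulr0 addr0.
Qed.

Lemma C1_gradB g h dg dh : C1_grad g dg -> C1_grad h dh ->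
  C1_grad (fun x => g x - h x) (fun i x => dg i x - dh i x).
Proof.
move=> Cg Ch; apply: C1_grad_eq (C1_gradD Cg (C1_gradZ (-1) Ch)) => [x _|i x _];
by rewrite mulN1r.
Qed.

Lemma C1_grad_sum (I : Type) (r : seq I) (g : I -> 'rV[R]_n -> R) dg :
  (forall k, C1_grad (g k) (dg k)) ->
  C1_grad (fun x => \sum_(k <- r) g k x) (fun i x => \sum_(k <- r) dg k i x).
Proof.
move=> Cg; elim: r => [|k r IH].
  by apply: C1_grad_eq (C1_grad_cst 0) => *; rewrite big_nil.
by apply: C1_grad_eq (C1_gradD (Cg k) IH) => *; rewrite big_cons.
Qed.

Lemma C1_grad_comp (f df : R -> R) g dg : C1_grad g dg ->
  (forall x, x != 0 -> is_derive (g x) (1 : R) f (df (g x)) /\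
                       {for g x, continuous df}) ->
  C1_grad (fun x => f (g x)) (fun i x => df (g x) * dg i x).
Proof.
move=> Cg Df x x0; have [cg Dg] := Cg x x0; have [dfx cdf] := Df x x0.
split=> [|i].
  apply: continuous_comp => //; apply/differentiable_continuous/derivable1_diffP.
  by case: dfx.
have [dgi cgi] := Dg i; split; first exact: is_derive_scalar_comp.
by apply: continuousM => //; exact: continuous_comp.
Qed.

Lemma C1_grad_expR g dg : C1_grad g dg ->
  C1_grad (fun x => expR (g x)) (fun i x => expR (g x) * dg i x).
Proof.
by move=> Cg; apply: C1_grad_comp => // x _; split; [exact: is_derive_expR|exact: continuous_expR].
Qed.

Lemma dotpC x y : dotp x y = dotp y x.
Proof. by apply: eq_bigr => i _; rewrite mulrC. Qed.

Lemma dotpxx_ge0 x : 0 <= dotp x x.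
Proof. by apply: sumr_ge0 => i _; rewrite -expr2 sqr_ge0. Qed.

Lemma dotpxx_eq0 x : (dotp x x == 0) = (x == 0).
Proof.
apply/idP/eqP => [|->]; last by rewrite /dotp big1// => i _; rewrite mxE mul0r.
rewrite psumr_eq0 => [/allP x0|i _]; last by rewrite -expr2 sqr_ge0.
apply/rowP => i; have := x0 i (mem_index_enum i).
by rewrite mxE -expr2 sqrf_eq0 => /eqP.
Qed.

Lemma enorm_ge0 x : 0 <= enorm x. Proof. exact: sqrtr_ge0. Qed.

Lemma sqr_enorm x : enorm x ^+ 2 = dotp x x.
Proof. by rewrite sqr_sqrtr// dotpxx_ge0. Qed.

Lemma enorm_gt0 x : (0 < enorm x) = (x != 0).
Proof. by rewrite /enorm sqrtr_gt0 lt_def dotpxx_ge0 andbT dotpxx_eq0. Qed.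

Lemma enorm_neq0 x : x != 0 -> enorm x != 0.
Proof. by rewrite -enorm_gt0 => /gt_eqF ->. Qed.

Lemma C1_grad_dotpl (v : 'rV[R]_n) : C1_grad (dotp v) (fun i _ => v 0 i).
Proof.
apply: C1_grad_eq (C1_grad_sum (index_enum 'I_n) (fun k => C1_gradZ (v 0 k) (C1_grad_coord k))) => //.
move=> i x _; rewrite (bigD1 i)//= eqxx mulr1 big1 ?addr0// => k ki.
by rewrite eq_sym (negbTE ki) mulr0.
Qed.

Lemma C1_grad_dotp : C1_grad (fun x => dotp x x) (fun i x => 2 * x 0 i).
Proof.
apply: C1_grad_eq (C1_grad_sum (index_enum 'I_n)
  (fun k => C1_gradM (C1_grad_coord k) (C1_grad_coord k))) => //.
move=> i x _; rewrite (bigD1 i)//= eqxx mulr1 big1 ?addr0 ?mulr_natl// => k ki.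
by rewrite eq_sym (negbTE ki) mulr0 addr0.
Qed.

Lemma C1_grad_enorm : C1_grad (@enorm R n) (fun i x => x 0 i / enorm x).
Proof.
have H : C1_grad (@enorm R n) (fun i x => (2 * enorm x)^-1 * (2 * x 0 i)).
  refine (@C1_grad_comp Num.sqrt (fun t => (2 * Num.sqrt t)^-1) _ _ C1_grad_dotp _) => x x0.
  have q0 : 0 < dotp x x by rewrite lt_def dotpxx_eq0 x0 dotpxx_ge0.
  split; first exact: is_derive1_sqrt.
  apply: continuousV; first by rewrite mulf_neq0// gt_eqF// sqrtr_gt0.
  by apply: continuousM; [exact: cst_continuous|exact: sqrt_continuous].
apply: C1_grad_eq H => // i x x0.
by field; exact: enorm_neq0.
Qed.

Lemma C1_grad_enormV :
  C1_grad (fun x => (enorm x)^-1) (fun i x => - x 0 i * (enorm x)^-1 ^+ 3).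
Proof.
have H : C1_grad (fun x => (enorm x)^-1) (fun i x => - (enorm x) ^- 2 * (x 0 i / enorm x)).
  refine (@C1_grad_comp GRing.inv (fun t => - t ^- 2) _ _ C1_grad_enorm _) => x x0.
  have e0 := enorm_neq0 x0.
  split.
    have := @is_deriveV R id (enorm x) 1 1 e0 (is_derive_id _ _).
    by rewrite [_ *: _]mulr1.
  apply: continuousN; apply: continuousV; first by rewrite expf_neq0.
  exact: exprn_continuous.
apply: C1_grad_eq H => // i x x0.
by rewrite exprVn; field; exact: enorm_neq0.
Qed.

End calculus.

(** * Continuous partial derivatives give differentiability *)

Section differentiability.
Context {R : realType} {n : nat}.
Implicit Types (g h : 'rV[R]_n -> R) (x y v : 'rV[R]_n).

Lemma ler_rV_coord v i : `|v 0 i| <= `|v|.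
Proof.
rewrite [leRHS]/Num.Def.normr/= mx_normrE.
exact: (le_bigmax _ (fun ij => `|v ij.1 ij.2|) (0, i)).
Qed.

Lemma mean_value_ineq (f df : R -> R) (a M : R) :
  (forall t, `|t| <= `|a| -> is_derive t (1 : R) f (df t)) ->
  (forall t, `|t| <= `|a| -> `|df t| <= M) ->
  `|f a - f 0| <= M * `|a|.
Proof.
move=> Df dfM.
have cf (b c : R) : (forall t, t \in `[b, c] -> `|t| <= `|a|) ->
    {within `[b, c], continuous f}.
  move=> bc; apply: derivable_within_continuous => t /bc /Df[].
  by [].
have [a0|a0] := leP 0 a.
  have sub t : t \in `[0, a] -> `|t| <= `|a|.
    by rewrite in_itv/= => /andP[t0 ta]; rewrite !ger0_norm.
  have [||c cI ->] := @MVT_segment R f df 0 a a0.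
  - by move=> t tI; apply/Df/sub; apply: subset_itv_oo_cc tI.
  - exact: cf.
  - by rewrite subr0 normrM ler_wpM2r// dfM// sub.
have sub t : t \in `[a, 0] -> `|t| <= `|a|.
  by rewrite in_itv/= => /andP[ta t0]; rewrite !ler0_norm ?lerN2// ltW.
have [||c cI] := @MVT_segment R f df a 0 (ltW a0).
- by move=> t tI; apply/Df/sub; apply: subset_itv_oo_cc tI.
- exact: cf.
- by rewrite sub0r distrC => ->; rewrite normrM normrN ler_wpM2r// dfM// sub.
Qed.

(** The increment from x to x + h is split into n moves, each changing one coordinate; on each move
    the mean value inequality is applied to g minus its linear part, whose derivative is small by
    continuity of the partials at x. *)
Lemma C1_grad_taylor g dg x : C1_grad g dg -> x != 0 -> forall e, 0 < e ->
  \forall h \near (0 : 'rV[R]_n),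
    `|g (h + x) - g x - \sum_i h 0 i * dg i x| <= e * `|h|.
Proof.
(* Each of the n moves costs at most [e'] times |h|; dividing by n + 1 keeps the quotient meaningful
   when n = 0. *)
move=> Cg x0 e e0; pose e' := e / n.+1%:R.
have e'0 : 0 < e' by rewrite divr_gt0.
have Dx : \forall y \near x, y != 0 /\ forall i, `|dg i y - dg i x| <= e'.
  near=> y; split; first by near: y; exact: near_neq0.
  near: y; apply: filter_forall => i; have [_ /(_ i)[_ ci]] := Cg x x0.
  have /cvgrPdist_le /(_ e' e'0) := ci.
  by apply: filterS => y; rewrite distrC.
have /nbhs_ballP[d /= d0 Bd] := Dx.
near=> h.
have hd : `|h| < d.
  near: h; apply/nbhs_ballP; exists d => // h /=.
  by rewrite -ball_normE /= sub0r normrN.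
(* [hk k] keeps the first k coordinates of h, so consecutive values differ in one coordinate and the
   increments telescope. *)
pose hk k : 'rV[R]_n := \row_i (if (i < k)%N then h 0 i else 0).
have hk0 : hk 0%N = 0 by apply/rowP => i; rewrite !mxE.
have hkn : hk n = h by apply/rowP => i; rewrite !mxE ltn_ord.
have hkS (k : 'I_n) t : t *: delta_mx 0 k + (hk k + x) =
    \row_i (if (i < k)%N then h 0 i else if i == k then t else 0) + x.
  rewrite addrA; congr (_ + _); apply/rowP => i; rewrite !mxE eqxx /=.
  have [->|ik] := eqVneq i k; first by rewrite ltnn mulr1 addr0.
  by rewrite mulr0 add0r.
have hkSS (k : 'I_n) : hk k.+1 + x = h 0 k *: delta_mx 0 k + (hk k + x).
  rewrite hkS; congr (_ + _); apply/rowP => i; rewrite !mxE ltnS leq_eqVlt.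
  have [->|ik] := eqVneq i k; first by rewrite ltnn eqxx.
  by rewrite (inj_eq val_inj) (negbTE ik).
have in_ball (k : 'I_n) t : `|t| <= `|h 0 k| ->
    ball x d (t *: delta_mx 0 k + (hk k + x)).
  move=> th; rewrite -ball_normE /= hkS opprD addrCA subrr addr0 normrN.
  apply: le_lt_trans hd; rewrite [leLHS]/Num.Def.normr/= mx_normrE.
  apply: bigmax_le => // -[i j] _ /=; rewrite mxE.
  case: ifP => _; first exact: ler_rV_coord.
  case: ifP => _; last by rewrite normr0.
  by apply: le_trans th _; exact: ler_rV_coord.
have step (k : 'I_n) :
    `|g (hk k.+1 + x) - g (hk k + x) - h 0 k * dg k x| <= e' * `|h 0 k|.
  pose f t := g (t *: delta_mx 0 k + (hk k + x)) - t * dg k x.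
  have := @mean_value_ineq f (fun t => dg k (t *: delta_mx 0 k + (hk k + x)) - dg k x)
    (h 0 k) e'.
  rewrite /f -hkSS mul0r subr0 scale0r add0r addrAC; apply.
  - move=> t /in_ball /Bd[y0 _]; apply: is_deriveB.
      by apply: is_derive_affine; have [_ /(_ k)[]] := Cg _ y0.
    by apply: is_derive_eq; rewrite scaler0 add0r [_ *: _]mulr1.
  - by move=> t /in_ball /Bd[_ /(_ k)].
have -> : g (h + x) - g x = \sum_(k < n) (g (hk k.+1 + x) - g (hk k + x)).
  rewrite -(big_mkord xpredT (fun k => g (hk k.+1 + x) - g (hk k + x))).
  by rewrite telescope_sumr// hk0 hkn add0r.
rewrite -sumrB; apply: le_trans (ler_norm_sum _ _ _) _.
apply: (@le_trans _ _ (\sum_(k < n) e' * `|h|)).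
  apply: ler_sum => k _; apply: le_trans (step k) _.
  by rewrite ler_pM2l// ler_rV_coord.
rewrite sumr_const card_ord -mulrnAl ler_wpM2r// -mulr_natr /e' mulrAC.
by rewrite ler_pdivrMr// ler_pM2l// ler_nat.
Unshelve. all: by end_near. Qed.

(** The candidate differential, given its own name so that it can carry a linear structure. *)
Definition row_functional (a : 'I_n -> R) (v : 'rV[R]_n) : R := \sum_i v 0 i * a i.

Lemma row_functional_is_linear a : linear (row_functional a).
Proof.
move=> k u v; rewrite /row_functional scaler_sumr -big_split /=.
by apply: eq_bigr => i _; rewrite !mxE mulrDl scalerAl.
Qed.

HB.instance Definition _ a := GRing.isLinear.Build R 'rV[R]_n R _ (row_functional a)
  (row_functional_is_linear a).

Lemma row_functional_continuous a : continuous (row_functional a).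
Proof.
rewrite /row_functional; elim: (index_enum 'I_n) => [|i s IH] x.
  by under eq_fun do rewrite big_nil; exact: cst_continuous.
rewrite (_ : (fun _ => _) = (fun v => v 0 i * a i) + (fun v => \sum_(k <- s) v 0 k * a k)).
  apply: continuousD; last exact: IH.
  by apply: continuousM; [exact: coord_continuous|exact: cst_continuous].
by apply/funext => v; rewrite big_cons.
Qed.

Lemma C1_grad_diff g dg x : C1_grad g dg -> x != 0 ->
  differentiable g x /\ 'd g x = row_functional (dg^~ x) :> (_ -> _).
Proof.
move=> Cg x0; pose l := row_functional (dg^~ x).
have E : (g \o shift x : 'rV[R]_n -> R^o) =
    cst (g x : R^o) + (l : 'rV[R]_n -> R^o) +o_ (0 : 'rV[R]_n) id.
  apply/eqaddoP => _/posnumP[e]; have := C1_grad_taylor Cg x0 [gt0 of e%:num].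
  apply: filterS => h; apply: le_trans; rewrite le_eqVlt; apply/orP; left.
  by rewrite /= !fctE opprD addrA.
have cl : continuous l by exact: row_functional_continuous.
have dE : 'd g x = l :> (_ -> _) by exact: diff_unique.
by split=> //; apply/diff_locallyP; rewrite dE.
Qed.

Lemma C1_grad_is_derive_curve g dg (c : R -> 'rV[R]_n) (dc : 'rV[R]_n) (t : R) :
  C1_grad g dg -> c t != 0 ->
  (forall i, is_derive t (1 : R) (fun s => c s 0 i) (dc 0 i)) ->
  is_derive t (1 : R) (fun s => g (c s)) (\sum_i dc 0 i * dg i (c t)).
Proof.
move=> Cg ct0 Dc; have [dgc dgE] := C1_grad_diff Cg ct0.
have Dct : derivable c t 1 by apply/derivable_mxP => i j; rewrite ord1; case: (Dc j).
have dfc : differentiable c t by apply/derivable1_diffP.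
have dgoc : differentiable (g \o c) t by apply: differentiable_comp.
split; first exact/derivable1_diffP.
rewrite -[LHS]/('D_1 (g \o c) t) deriveE// diff_comp//= dgE -deriveE// derive_mx//.
by apply: eq_bigr => i _; rewrite mxE (@derive_val _ _ _ _ _ _ _ (Dc i)).
Qed.
End differentiability.

(** * Integration over the sphere *)

Section sphere_integral.
Context {R : realType} {n : nat}.
Implicit Types (f g : 'rV[R]_n -> R) (x y v w : 'rV[R]_n).
Local Notation S := (@usphere R n).

(** The class of all integrands: it is stable under the algebra used below, and since the sphere is
    compact and avoids 0 it gives measurability and boundedness there, hence integrability for a
    probability. *)
Definition cont_off0 f := forall x, x != 0 -> {for x, continuous f}.

Lemma C1_grad_cont_off0 f df : C1_grad f df -> cont_off0 f.
Proof. by move=> Cf x /Cf[]. Qed.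

Lemma C1_grad_cont_off0_partial f df i : C1_grad f df -> cont_off0 (df i).
Proof. by move=> Cf x /Cf[_ /(_ i)[]]. Qed.

Lemma cont_off0_cst (a : R) : cont_off0 (fun=> a).
Proof. by move=> x _; exact: cst_continuous. Qed.

Lemma cont_off0_coord i : cont_off0 (fun w => w 0 i).
Proof. by move=> x _; exact: coord_continuous. Qed.

Lemma cont_off0D f g : cont_off0 f -> cont_off0 g -> cont_off0 (fun w => f w + g w).
Proof. by move=> cf cg x x0; apply: continuousD; [exact: cf|exact: cg]. Qed.

Lemma cont_off0M f g : cont_off0 f -> cont_off0 g -> cont_off0 (fun w => f w * g w).
Proof. by move=> cf cg x x0; apply: continuousM; [exact: cf|exact: cg]. Qed.

Lemma cont_off0N f : cont_off0 f -> cont_off0 (fun w => - f w).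
Proof. by move=> cf x x0; apply: continuousN; exact: cf. Qed.

Lemma cont_off0B f g : cont_off0 f -> cont_off0 g -> cont_off0 (fun w => f w - g w).
Proof. by move=> cf cg; apply: cont_off0D => //; exact: cont_off0N. Qed.

Lemma cont_off0_sum (I : Type) (s : seq I) (F : I -> 'rV[R]_n -> R) :
  (forall i, cont_off0 (F i)) -> cont_off0 (fun w => \sum_(i <- s) F i w).
Proof.
move=> cF; elim: s => [|i s IH].
  by under eq_fun do rewrite big_nil; exact: cont_off0_cst.
by under eq_fun do rewrite big_cons; exact: cont_off0D.
Qed.

Lemma cont_off0X f k : cont_off0 f -> cont_off0 (fun w => f w ^+ k).
Proof.
move=> cf; elim: k => [|k IH].
  by under eq_fun do rewrite expr0; exact: cont_off0_cst.
by under eq_fun do rewrite exprS; exact: cont_off0M.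
Qed.

Lemma cont_off0_dotp v : cont_off0 (fun w => dotp w v).
Proof. by apply: cont_off0_sum => i; apply: cont_off0M; [exact: cont_off0_coord|exact: cont_off0_cst]. Qed.

Lemma cont_off0_comp (h : R -> R) f : continuous h -> cont_off0 f -> cont_off0 (fun w => h (f w)).
Proof. by move=> ch cf x x0; apply: continuous_comp; [exact: cf|exact: ch]. Qed.

Lemma usphere_neq0 w : S w -> w != 0.
Proof.
by move=> Sw; rewrite -enorm_gt0 (_ : enorm w = 1).
Qed.

Lemma dotp_usphere w : S w -> dotp w w = 1.
Proof. by move=> Sw; rewrite -sqr_enorm (_ : enorm w = 1) ?expr1n. Qed.

Lemma usphereE w : S w <-> dotp w w = 1.
Proof.
by split=> [/dotp_usphere//|w1]; rewrite /usphere /= /enorm w1 sqrtr1.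
Qed.

Lemma coord_usphere_le1 w i : S w -> `|w 0 i| <= 1.
Proof.
move=> /dotp_usphere w1; rewrite -(@expr_le1 _ 2)// real_normK ?num_real// -w1.
rewrite /dotp (bigD1 i)//= -expr2 lerDl; apply: sumr_ge0 => k _.
by rewrite -expr2 sqr_ge0.
Qed.

Lemma continuous_dotp : continuous (fun w => dotp w w).
Proof.
move=> x; rewrite /dotp; elim: (index_enum 'I_n) => [|i s IH].
  by under eq_fun do rewrite big_nil; exact: cst_continuous.
rewrite (_ : (fun _ => _) = (fun v => v 0 i * v 0 i) + (fun v => \sum_(k <- s) v 0 k * v 0 k)).
  by apply: continuousD => //; apply: continuousM; exact: coord_continuous.
by apply/funext => v; rewrite big_cons.
Qed.

Lemma usphere_closed : closed S.
Proof.
rewrite (_ : S = (fun w => dotp w w) @^-1` [set 1]).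
  by apply: preimage_closed => [x _|]; [exact: continuous_dotp|exact: closed_eq].
by apply/seteqP; split=> w /usphereE.
Qed.

Lemma usphere_compact : compact S.
Proof.
apply: bounded_closed_compact usphere_closed.
exists 1; split => // M M1 w Sw /=; rewrite [leLHS]/Num.Def.normr/= mx_normrE.
have M0 : 0 <= M by apply: ltW; apply: lt_trans M1.
apply: bigmax_le => // -[i j] _ /=.
by rewrite ord1 (le_trans (coord_usphere_le1 _ Sw))// ltW.
Qed.

Lemma cont_off0_bounded f : cont_off0 f -> exists M, forall w, S w -> `|f w| <= M.
Proof.
move=> cf.
have : {within S, continuous (f : 'rV[R]_n -> R^o)}.
  by apply: continuous_in_subspaceT => x /set_mem /usphere_neq0 /cf.
move=> /continuous_compact /(_ usphere_compact) /compact_bounded[M [_ MP]].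
exists (M + 1) => w Sw; apply: (MP (M + 1)); first by rewrite ltrDl.
by exists w.
Qed.

Lemma measurable_open (A : set 'rV[R]_n) : open A -> measurable (A : set (borelRV R n)).
Proof. by move=> oA; exact: sub_sigma_algebra. Qed.

Lemma measurable_usphere : measurable (S : set (borelRV R n)).
Proof.
by rewrite -[S]setCK; apply: measurableC; apply: measurable_open; apply: closed_openC; exact: usphere_closed.
Qed.

(** Continuity at 0 is unknown, so the superlevel set is cut down to x != 0; this does not change
    its trace on the sphere. *)
Lemma open_nonzero_gt f a : cont_off0 f -> open [set w | w != 0 /\ a < f w].
Proof.
move=> cf; rewrite openE => w [w0 aw] /=.
rewrite /interior; near=> y; split; near: y; first exact: near_neq0.
exact: (cvgr_gt _ (cf w w0)).
Unshelve. all: by end_near. Qed.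

Lemma cont_off0_measurable f : cont_off0 f -> measurable_fun (S : set (borelRV R n)) f.
Proof.
move=> cf; apply: (measurability _ (measurable_realfun.RGenOInfty.measurableE R)).
move=> _ [_ [a ->] <-].
rewrite (_ : _ `&` _ = S `&` [set w | w != 0 /\ a < f w]).
  apply: measurableI; first exact: measurable_usphere.
  by apply: measurable_open; exact: open_nonzero_gt.
apply/seteqP; split=> w /= [Sw]; rewrite in_itv/= andbT => aw; split=> //.
  by split=> //; exact: usphere_neq0.
by case: aw.
Unshelve. all: by end_near. Qed.

Section probability.
Context (mu : probability (borelRV R n) R).
Local Notation "'E[' f ]" := (\int[mu]_(w in S) f w).

Lemma cont_off0_integrable f : cont_off0 f -> mu.-integrable S (EFin \o f).
Proof.
move=> cf; apply: measurable_bounded_integrable.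
- exact: measurable_usphere.
- by apply: le_lt_trans (probability_le1 mu measurable_usphere) _; rewrite ltry.
- exact: cont_off0_measurable.
- have [M MP] := cont_off0_bounded cf; exists M; split; first exact: num_real.
  by move=> N MN w Sw /=; apply: le_trans (MP w Sw) _; exact: ltW.
Qed.

Lemma sphere_intD f g : cont_off0 f -> cont_off0 g -> E[fun w => f w + g w] = E[f] + E[g].
Proof.
by move=> cf cg; apply: RintegralD; [exact: measurable_usphere|exact: cont_off0_integrable..].
Qed.

Lemma sphere_intB f g : cont_off0 f -> cont_off0 g -> E[fun w => f w - g w] = E[f] - E[g].
Proof.
by move=> cf cg; apply: RintegralB; [exact: measurable_usphere|exact: cont_off0_integrable..].
Qed.

Lemma sphere_intZ (a : R) f : cont_off0 f -> E[fun w => a * f w] = a * E[f].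
Proof.
by move=> cf; apply: RintegralZl; [exact: measurable_usphere|exact: cont_off0_integrable].
Qed.

Lemma sphere_int_sum (I : Type) (s : seq I) (F : I -> 'rV[R]_n -> R) :
  (forall i, cont_off0 (F i)) ->
  E[fun w => \sum_(i <- s) F i w] = \sum_(i <- s) E[F i].
Proof.
move=> cF; elim: s => [|i s IH].
  rewrite big_nil; under eq_fun do rewrite big_nil.
  by rewrite Rintegral_cst ?mul0r//; exact: measurable_usphere.
rewrite big_cons -IH -sphere_intD//; last exact: cont_off0_sum.
by apply: eq_Rintegral => w _; rewrite big_cons.
Qed.

Lemma eq_sphere_int f g : (forall w, S w -> f w = g w) -> E[f] = E[g].
Proof. by move=> fg; apply: eq_Rintegral => w /set_mem; exact: fg. Qed.

End probability.
End sphere_integral.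

(** * Infinitesimal rotations integrate to zero *)

Lemma Rintegral_bounded_cvg d (T : measurableType d) (R : realType)
    (mu : {measure set T -> \bar R}) (D : set T) (f_ : nat -> T -> R) (f : T -> R) (M : R) :
  measurable D -> (mu D < +oo)%E -> (forall k, measurable_fun D (f_ k)) ->
  (forall x, D x -> f_ k x @[k --> \oo] --> f x) ->
  (forall k x, D x -> `|f_ k x| <= M) ->
  \int[mu]_(x in D) f_ k x @[k --> \oo] --> \int[mu]_(x in D) f x.
Proof.
move=> mD muD mf_ f_f f_M.
have mf : measurable_fun D f by exact: measurable_fun_cvg f_f.
have iM : mu.-integrable D (EFin \o cst M).
  apply: measurable_bounded_integrable => //.
  by exists `|M|; split; [exact: num_real|move=> N /ltW MN x _].
have [||||| fi _ cv] := @dominated_convergence _ _ _ mu D mD (fun k => EFin \o f_ k)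
   (EFin \o f) (EFin \o cst M).
- by move=> k; apply/measurable_EFinP.
- exact/measurable_EFinP.
- by apply: aeW => x Dx; apply/fine_cvgP; split; [exact: nearW|exact: f_f].
- exact: iM.
- by apply: aeW => x k Dx; rewrite /= lee_fin f_M.
apply: fine_cvg; rewrite fineK//; exact: integrable_fin_num.
Qed.

(** Dominated convergence is applied to sequences, so the limit defining a derivative is sampled at
    the steps 1/(k+1), which are nonzero. *)
Lemma cvg_harmonic_dnbhs (R : realType) : (harmonic : nat -> R) @ \oo --> (0 : R)^'.
Proof.
move=> A /(@cvg_harmonic R)[N _ NA]; exists N => // k Nk.
by apply: (NA k Nk); rewrite /harmonic /= invr_eq0 pnatr_eq0.
Qed.

Section rotation_invariance.
Context {R : realType} {n : nat}.
Implicit Types (f g : 'rV[R]_n -> R) (x y v w : 'rV[R]_n).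
Local Notation S := (@usphere R n).

Lemma continuous_rV (T : topologicalType) (f : T -> 'rV[R]_n) (t : T) :
  (forall i, {for t, continuous (fun s => f s 0 i)}) -> {for t, continuous f}.
Proof.
move=> cf; apply/cvgrPdist_le => /= e e0; near=> s.
rewrite [leLHS]/Num.Def.normr/= mx_normrE.
apply: bigmax_le => [|[i j] _ /=]; first exact: ltW.
rewrite ord1 !mxE; move: j {i}; near: s; apply: filter_forall => j.
exact: (cvgrPdist_le _ _).1 (cf j) e e0.
Unshelve. all: by end_near. Qed.

Lemma continuous_mulmxr (U : 'M[R]_n) : continuous (fun w : 'rV[R]_n => w *m U).
Proof.
move=> x; apply: continuous_rV => i.
rewrite (_ : (fun _ => _) = row_functional (fun k => U k i)).
  exact: row_functional_continuous.
by apply/funext => w; rewrite mxE.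
Qed.

Lemma measurable_mulmxr (U : 'M[R]_n) :
  measurable_fun [set: borelRV R n] (fun w : borelRV R n => (w : 'rV[R]_n) *m U : borelRV R n).
Proof.
refine (@measurability _ _ (borelRV R n) (borelRV R n) setT _ (@open 'rV[R]_n) erefl _).
move=> _ [A oA <-]; rewrite setTI; apply: measurable_open.
have /continuousP : continuous (fun w : 'rV[R]_n => w *m U) by exact: continuous_mulmxr.
exact.
Qed.

Lemma dotp_mulmx (U : 'M[R]_n) x y : dotp (x *m U) y = dotp x (y *m U^T).
Proof.
rewrite /dotp; under eq_bigr do rewrite mxE mulr_suml.
rewrite exchange_big /=; apply: eq_bigr => i _.
by rewrite mxE mulr_sumr; apply: eq_bigr => k _; rewrite mxE; ring.
Qed.

Lemma dotp_orthogonal (U : 'M[R]_n) x : U *m U^T = 1%:M -> dotp (x *m U) (x *m U) = dotp x x.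
Proof. by move=> UU; rewrite dotp_mulmx -mulmxA UU mulmx1. Qed.

Lemma usphere_orthogonal (U : 'M[R]_n) x : U *m U^T = 1%:M -> S (x *m U) <-> S x.
Proof. by move=> UU; rewrite !usphereE dotp_orthogonal. Qed.

Context (mu : probability (borelRV R n) R) (hmu : uniform_on_sphere mu).
Local Notation "'E[' f ]" := (\int[mu]_(w in S) f w).

(** Invariance says that the image of [mu] under w -> wU is [mu], so this is the change of variables
    formula; the domain is moved into the integrand, the sphere being its own preimage. *)
Lemma sphere_int_orthogonal (U : 'M[R]_n) f : U *m U^T = 1%:M -> cont_off0 f ->
  E[fun w => f (w *m U)] = E[f].
Proof.
move=> UU cf; pose phi (w : borelRV R n) : borelRV R n := (w : 'rV[R]_n) *m U.
have mphi : measurable_fun setT phi by exact: measurable_mulmxr.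
have SE : phi @^-1` S = S by apply/seteqP; split=> w /usphere_orthogonal; apply.
rewrite /Rintegral; congr fine.
rewrite [RHS](@eq_measure_integral _ _ _ _ (pushforward mu phi)); last first.
  by move=> A mA _; apply: esym; exact: (hmu.2 U UU A mA).
pose g : borelRV R n -> \bar R := (EFin \o f) \_ S.
have mS := @measurable_usphere R n.
have mg : @measurable_fun _ _ (borelRV R n) _ setT g.
  apply/(measurable_restrictT _ mS); apply/measurable_EFinP.
  exact: cont_off0_measurable.
have gphi : g \o phi = (EFin \o (f \o phi)) \_ S.
  apply/funext => w; rewrite /g /= !patchE.
  suff -> : (phi w \in S) = (w \in S) by [].
  by apply/idP/idP => /set_mem H; apply/mem_set; apply/(usphere_orthogonal w UU).
have cfphi : cont_off0 (f \o phi).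
  move=> w w0; apply: continuous_comp; first exact: continuous_mulmxr.
  by apply: cf; rewrite -dotpxx_eq0 dotp_orthogonal// dotpxx_eq0.
rewrite [LHS]integral_mkcond [RHS]integral_mkcond -[X in _ = integral _ _ X]/g.
rewrite (integral_pushforward mphi mg)//.
  by rewrite preimage_setT gphi.
rewrite preimage_setT gphi; apply/(integrable_mkcond _ mS).1.
exact: cont_off0_integrable.
Qed.

(** The relations give A^3 = -A, so U is the Rodrigues form of exp(tA) with A skew; orthogonality
    comes down to cos^2 + sin^2 = 1. *)
Lemma orthogonal_of_skew (P A : 'M[R]_n) (t : R) :
  P *m P = P -> P *m A = A -> A *m P = A -> A *m A = - P ->
  P^T = P -> A^T = - A ->
  let U := 1%:M + (cos t - 1) *: P + sin t *: A in U *m U^T = 1%:M.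
Proof.
move=> PP PA AP AA PT AT U.
have -> : U^T = 1%:M + (cos t - 1) *: P - sin t *: A.
  by rewrite /U 2!raddfD /= trmx1 !linearZ /= PT AT scalerN.
rewrite /U !(mulmxDl, mulmxDr, mulmxN) !mulmx1 !mul1mx.
rewrite -!scalemxAl -!scalemxAr PP PA AP AA !scalerA.
apply/matrixP => k l; rewrite !mxE.
have := cos2Dsin2 t; move: (_ == _)%:R (P k l) (A k l) (cos t) (sin t) => a p q c s cs.
rewrite -[RHS]addr0 -(mul0r p) -(subrr 1) -{1}cs; ring.
Qed.

Section planar_rotation.
Context (i j : 'I_n) (ij : i != j).

Let P : 'M[R]_n := delta_mx i i + delta_mx j j.
Let A : 'M[R]_n := delta_mx i j - delta_mx j i.

(** Here [P] projects onto the plane of the coordinates i and j, and [A] generates the rotations of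
    that plane. *)
Definition planar_rotation (t : R) : 'M[R]_n :=
  1%:M + (cos t - 1) *: P + sin t *: A.

Let PP : P *m P = P.
Proof.
rewrite /P mulmxDl !mulmxDr !mul_delta_mx_cond eqxx (negbTE ij) eq_sym (negbTE ij).
by rewrite eqxx !mulr1n !mulr0n add0r addr0.
Qed.

Let PA : P *m A = A.
Proof.
rewrite /P /A mulmxDl !mulmxBr !mul_delta_mx_cond !eqxx (negbTE ij) eq_sym (negbTE ij).
by rewrite !mulr1n !mulr0n add0r subr0.
Qed.

Let AP : A *m P = A.
Proof.
rewrite /P /A mulmxBl !mulmxDr !mul_delta_mx_cond !eqxx (negbTE ij) eq_sym (negbTE ij).
by rewrite !mulr1n !mulr0n add0r addr0.
Qed.

Let AA : A *m A = - P.
Proof.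
rewrite /P /A mulmxBl !mulmxBr !mul_delta_mx_cond !eqxx (negbTE ij) eq_sym (negbTE ij).
by rewrite !mulr1n !mulr0n add0r subr0 opprD.
Qed.

Lemma planar_rotation_orthogonal t :
  planar_rotation t *m (planar_rotation t)^T = 1%:M.
Proof.
have PT : P^T = P by rewrite /P linearD /= !trmx_delta.
have AT : A^T = - A by rewrite /A linearB /= !trmx_delta opprB.
exact: orthogonal_of_skew.
Qed.

Lemma mulmx_skew w k :
  (w *m A) 0 k = w 0 i * (k == j)%:R - w 0 j * (k == i)%:R.
Proof.
rewrite /A mulmxBr !mxE.
rewrite (bigD1 i)//= mxE !eqxx /= big1 ?addr0; last first.
  by move=> l li; rewrite mxE (negbTE li) mulr0.
rewrite (bigD1 j)//= mxE !eqxx /= big1 ?addr0//.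
by move=> l li; rewrite mxE (negbTE li) mulr0.
Qed.

(** The velocity is [A] applied to the moved point, not to w: the derivative of f along the orbit is
    then one fixed function evaluated on the orbit, so a single bound serves for all t. *)
Lemma is_derive_planar_rotation w t k :
  is_derive t (1 : R) (fun s => (w *m planar_rotation s) 0 k)
    ((w *m planar_rotation t *m A) 0 k).
Proof.
have -> : (fun s => (w *m planar_rotation s) 0 k) = (fun s =>
    w 0 k + (cos s - 1) * (w *m P) 0 k + sin s * (w *m A) 0 k).
  apply/funext => s; rewrite /planar_rotation 2!mulmxDr mulmx1 -2!scalemxAr.
  by move: (w *m P) (w *m A) => p a; rewrite !mxE.
apply: is_derive_eq.
rewrite -mulmxA /planar_rotation 2!mulmxDl mul1mx -2!scalemxAl PA AA.
rewrite 2!mulmxDr -2!scalemxAr mulmxN; move: (w *m P) (w *m A) => p a.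
rewrite !mxE /GRing.scale /=.
ring.
Qed.

(** By invariance the difference quotients of f along the rotation have integral zero. They converge
    pointwise to the generator applied to f and, by the mean value inequality along orbits, are
    bounded by its maximum on the sphere. *)
Lemma sphere_int_generator f df : C1_grad f df ->
  E[fun w => w 0 i * df j w - w 0 j * df i w] = 0.
Proof.
move=> Cf; pose L w := w 0 i * df j w - w 0 j * df i w.
have cf := C1_grad_cont_off0 Cf.
have cL : cont_off0 L.
  by apply: cont_off0B; apply: cont_off0M; (exact: cont_off0_coord || exact: C1_grad_cont_off0_partial Cf).
have [M LM] := cont_off0_bounded cL.
have SU w t : S w -> S (w *m planar_rotation t).
  by move=> Sw; apply/usphere_orthogonal => //; exact: planar_rotation_orthogonal.
have Df w t : S w -> is_derive t (1 : R) (fun s => f (w *m planar_rotation s))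
    (L (w *m planar_rotation t)).
  move=> Sw; apply: is_derive_eq.
    apply: (C1_grad_is_derive_curve (dc := w *m planar_rotation t *m A) Cf).
      exact/usphere_neq0/SU.
    by move=> k; exact: is_derive_planar_rotation.
  rewrite (eq_bigr (fun k => (w *m planar_rotation t) 0 i * ((k == j)%:R * df k (w *m planar_rotation t))
     - (w *m planar_rotation t) 0 j * ((k == i)%:R * df k (w *m planar_rotation t)))); last first.
    by move=> k _; rewrite mulmx_skew; ring.
  rewrite sumrB -!mulr_sumr (bigD1 j)//= eqxx mul1r big1 ?addr0; last first.
    by move=> k /negbTE ->; rewrite mul0r.
  by rewrite (bigD1 i)//= eqxx mul1r big1 ?addr0// => k /negbTE ->; rewrite mul0r.
pose q k w := (@harmonic R k)^-1 * (f (w *m planar_rotation (harmonic k)) - f w).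
have cfU t : cont_off0 (fun w => f (w *m planar_rotation t)).
  move=> w w0; apply: continuous_comp; first exact: continuous_mulmxr.
  by apply: cf; rewrite -dotpxx_eq0 dotp_orthogonal ?dotpxx_eq0//; exact: planar_rotation_orthogonal.
have cq k : cont_off0 (q k).
  by apply: cont_off0M; [exact: cont_off0_cst|exact: cont_off0B].
have Eq0 k : E[q k] = 0.
  rewrite sphere_intZ; last exact: cont_off0B.
  rewrite sphere_intB// (sphere_int_orthogonal (planar_rotation_orthogonal _))//.
  by rewrite subrr mulr0.
have rot0 w : w *m planar_rotation 0 = w.
  by rewrite /planar_rotation cos0 sin0 subrr !scale0r !addr0 mulmx1.
have : E[q k] @[k --> \oo] --> E[L].
  apply: (@Rintegral_bounded_cvg _ _ _ _ _ _ _ M).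
  - exact: measurable_usphere.
  - by apply: le_lt_trans (probability_le1 mu (@measurable_usphere R n)) _; rewrite ltry.
  - by move=> k; exact: cont_off0_measurable.
  - move=> w Sw; have [d0 dE] := Df w 0 Sw.
    move: dE; rewrite rot0 => <-.
    have := cvg_comp _ _ (@cvg_harmonic_dnbhs R) d0.
    apply: cvg_trans; apply: near_eq_cvg; apply: nearW => k /=.
    by rewrite addr0 [_%:A]mulr1 rot0.
  - move=> k w Sw.
    have h0 : 0 < @harmonic R k by exact: harmonic_gt0.
    have := @mean_value_ineq R (fun s => f (w *m planar_rotation s))
      (fun s => L (w *m planar_rotation s)) (harmonic k) M.
    rewrite rot0 => H; rewrite /q normrM normfV ler_pdivrMl ?normr_gt0 ?gt_eqF//.
    by rewrite mulrC; apply: H => [t _|t _]; [exact: Df|apply: LM; exact: SU].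
under eq_fun do rewrite Eq0.
by move=> /(cvg_lim (@Rhausdorff R)) <-; rewrite lim_cst.
Qed.
End planar_rotation.

End rotation_invariance.

(** * Divergence theorem, transitivity and full support *)

Section divergence.
Context {R : realType} {n : nat}.
Implicit Types (f g : 'rV[R]_n -> R) (x y v w : 'rV[R]_n).
Local Notation S := (@usphere R n).
Context (mu : probability (borelRV R n) R) (hmu : uniform_on_sphere mu).
Local Notation "'E[' f ]" := (\int[mu]_(w in S) f w).

(* The generators L_ij = x_i d_j - x_j d_i of the rotations integrate to zero;
   applied to x_i V_j and summed over i and j, they give the divergence of V. *)
Lemma tangent_divergence (V : 'I_n -> 'rV[R]_n -> R) dV :
  (forall k, C1_grad (V k) (dV k)) ->
  (forall x, x != 0 -> \sum_k x 0 k * V k x = 0) ->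
  E[fun w => \sum_k dV k k w] = 0.
Proof.
move=> CV tV.
(* The generator applied to x_i V_j, expanded by the product rule. *)
pose L i j w := w 0 i * (w 0 i * dV j j w + V j w * (j == i)%:R) -
                w 0 j * (w 0 i * dV j i w + V j w * (i == i)%:R).
have EL i j : E[L i j] = 0.
  have [<-|ij] := eqVneq i j.
    rewrite /L -[RHS](@Rintegral_set0 _ _ _ mu (fun=> 0)).
    under eq_Rintegral do rewrite subrr.
    by rewrite Rintegral_set0 Rintegral_cst ?mul0r//; exact: measurable_usphere.
  exact: (sphere_int_generator hmu ij (C1_gradM (C1_grad_coord i) (CV j))).
have cV k : cont_off0 (V k) := C1_grad_cont_off0 (CV k).
have cdV k i : cont_off0 (dV k i) := C1_grad_cont_off0_partial (CV k).
have cL i j : cont_off0 (L i j).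
  have cw k : cont_off0 (fun w => w 0 k) by exact: cont_off0_coord.
  have cV1 (a : R) : cont_off0 (fun w => V j w * a) by apply: cont_off0M => //; exact: cont_off0_cst.
  have cwdV k : cont_off0 (fun w => w 0 i * dV j k w) by exact: cont_off0M.
  by apply: cont_off0B; apply: cont_off0M => //; exact: cont_off0D.
(* The tangency identity x.V = 0 holds on an open set, so it can be differentiated in direction
   i. *)
have tdV i x : x != 0 -> \sum_k x 0 k * dV k i x = - V i x.
  move=> x0; apply/eqP; rewrite -addr_eq0; apply/eqP.
  have C := C1_grad_sum (index_enum 'I_n) (fun k => C1_gradM (C1_grad_coord k) (CV k)).
  have C0 := C1_grad_eq tV (fun _ _ _ => erefl) C.
  have := C1_grad_partial i C0 x0.
  rewrite (C1_grad_partial i (C1_grad_cst 0))// big_split /= => E0; rewrite [RHS]E0; congr (_ + _).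
  by rewrite (bigD1 i)//= eqxx mulr1 big1 ?addr0// => k; rewrite eq_sym => /negbTE ->; rewrite mulr0.
transitivity (E[fun w => \sum_i \sum_j L i j w]).
  apply: eq_sphere_int => w Sw; have w0 := usphere_neq0 Sw.
  rewrite exchange_big /=.
  (* The inner sum over i, with |w| = 1. After summation over j, the terms w_j V_j vanish by
     tangency, and the last one becomes minus the sum of w_i V_i by the differentiated identity,
     hence vanishes as well. *)
  rewrite [RHS](eq_bigr (fun j => dV j j w + w 0 j * V j w - n%:R * (w 0 j * V j w)
      - w 0 j * \sum_i w 0 i * dV j i w)); last first.
    move=> j _; rewrite /L sumrB.
    under eq_bigr do rewrite mulrDr mulrA.
    rewrite big_split /= -mulr_suml -/(dotp w w) dotp_usphere// mul1r.
    rewrite (bigD1 j)//= eqxx mulr1 big1 ?addr0; last first.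
      by move=> i; rewrite eq_sym => /negbTE ->; rewrite !mulr0.
    under [X in _ - X]eq_bigr do rewrite eqxx mulr1.
    rewrite -mulr_sumr big_split /= sumr_const card_ord -mulr_natl; ring.
  rewrite !sumrB big_split /= -mulr_sumr tV// mulr0 addr0 subr0.
  under [X in _ - X]eq_bigr do rewrite mulr_sumr.
  rewrite [X in _ - X]exchange_big /=.
  rewrite [X in _ - X](eq_bigr (fun i => - (w 0 i * V i w))); last first.
    move=> i _; rewrite -mulrN -tdV// mulr_sumr; apply: eq_bigr => k _; ring.
  by rewrite sumrN tV// oppr0 subr0.
rewrite sphere_int_sum; last by move=> i; exact: cont_off0_sum.
rewrite big1// => i _; rewrite sphere_int_sum// big1//.
Qed.

Definition householder v : 'M[R]_n := 1%:M - (2 / dotp v v) *: (v^T *m v).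

Lemma mulmx_householder v w :
  w *m householder v = w - (2 * dotp w v / dotp v v) *: v.
Proof.
rewrite /householder mulmxBr mulmx1 -scalemxAr mulmxA.
have -> : w *m v^T = (dotp w v)%:M.
  rewrite [LHS]mx11_scalar mxE; congr (_%:M).
  by apply: eq_bigr => i _; rewrite mxE.
by rewrite mul_scalar_mx scalerA mulrAC.
Qed.

Lemma trmx_householder v : (householder v)^T = householder v.
Proof. by rewrite /householder linearB /= linearZ /= trmx1 trmx_mul trmxK. Qed.

Lemma dotpBl x y z : dotp (x - y) z = dotp x z - dotp y z.
Proof. by rewrite /dotp -sumrB; apply: eq_bigr => i _; rewrite !mxE mulrBl. Qed.

Lemma dotpZl (a : R) x y : dotp (a *: x) y = a * dotp x y.
Proof. by rewrite /dotp mulr_sumr; apply: eq_bigr => i _; rewrite !mxE mulrA. Qed.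

Lemma householder_orthogonal v : v != 0 -> householder v *m (householder v)^T = 1%:M.
Proof.
rewrite -dotpxx_eq0 => v0; rewrite trmx_householder; apply/row_matrixP => i.
rewrite !rowE mulmx1 mulmxA !mulmx_householder dotpBl dotpZl.
set e := delta_mx _ _; rewrite -addrA -opprD -scalerDl.
have -> : 2 * dotp e v / dotp v v +
  2 * (dotp e v - 2 * dotp e v / dotp v v * dotp v v) / dotp v v = 0 by field.
by rewrite scale0r subr0.
Qed.

(** For vectors of equal length, the reflection in the hyperplane orthogonal to x - y exchanges x
    and y. *)
Lemma usphere_transitive x y : S x -> S y ->
  exists U : 'M[R]_n, U *m U^T = 1%:M /\ x *m U = y.
Proof.
move=> Sx Sy; have [->|xy] := eqVneq x y.
  by exists 1%:M; rewrite trmx1 !mulmx1.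
have v0 : x - y != 0 by rewrite subr_eq0.
exists (householder (x - y)); split; first exact: householder_orthogonal.
have vv : dotp (x - y) (x - y) = 2 * dotp x (x - y).
  rewrite dotpBl [dotp y _]dotpC [dotp x _]dotpC !dotpBl (dotpC y x).
  by rewrite !dotp_usphere//; ring.
rewrite mulmx_householder -vv divff ?scale1r ?dotpxx_eq0//.
by rewrite opprB addrC subrK.
Qed.

(** The measure has full support. If f were positive at w0, the relatively open set where f >
    f(w0)/2 would be null; by transitivity its images under orthogonal maps cover the sphere, by
    compactness finitely many suffice, and by invariance each is null, contradicting total mass
    1. *)
Lemma sphere_int_ge0_eq0 f : cont_off0 f -> (forall w, S w -> 0 <= f w) ->
  E[f] = 0 -> forall w, S w -> f w = 0.
Proof.
move=> cf f0 Ef w0 Sw0; apply: contrapT => /eqP fw0N.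
have fw0 : 0 < f w0 by rewrite lt_def fw0N f0.
have mS := @measurable_usphere R n.
pose c := f w0 / 2; pose O := [set w | w != 0 /\ c < f w].
have oO : open O by exact: open_nonzero_gt.
pose A : set (borelRV R n) := S `&` O.
have mA : measurable A by apply: measurableI => //; exact: measurable_open.
have muA : mu A = 0%E.
  have iS : (\int[mu]_(w in S) (f w)%:E = 0)%E.
    by rewrite -[LHS]fineK ?[X in X%:E]Ef//; apply: integrable_fin_num => //; exact: cont_off0_integrable.
  have : (c%:E * mu A <= 0)%E.
    rewrite -(integral_cst _ mA) -iS; apply: (@le_trans _ _ (\int[mu]_(w in A) (f w)%:E)%E).
      apply: ge0_le_integral => //=.
      - by move=> w _; rewrite lee_fin /c divr_ge0// ltW.
      - apply/measurable_EFinP; apply: measurable_funS (cont_off0_measurable cf) => //.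
        by move=> w [].
      - by move=> w [_ [_ /ltW cfw]]; rewrite ?lee_fin.
    apply: ge0_subset_integral => //.
    - by apply/measurable_EFinP; exact: cont_off0_measurable.
    - by move=> w [].
  have c0 : 0 < c by rewrite divr_gt0.
  rewrite pmule_rle0 ?lte_fin// => muA0; apply/eqP; rewrite eq_le muA0 /=.
  exact: measure_ge0.
pose G (U : 'M[R]_n) : set 'rV[R]_n := [set x | O (x *m U)].
have oG U : [set U : 'M[R]_n | U *m U^T = 1%:M] U -> open (G U).
  have /continuousP cU : continuous (fun w : 'rV[R]_n => w *m U) by exact: continuous_mulmxr.
  by move=> _; exact: cU.
have covS : S `<=` cover [set U : 'M[R]_n | U *m U^T = 1%:M] G.
  move=> x Sx; have [U [UU xU]] := usphere_transitive Sx Sw0; exists U => //.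
  rewrite /G /= xU; split; first exact: usphere_neq0.
  by rewrite /c ltr_pdivrMr// ltr_pMr// ltr1n.
have := @usphere_compact R n; rewrite compact_cover => /(_ _ _ _ oG covS)[D DO covD].
have neg (s : seq 'M[R]_n) : (forall U, U \in s -> U *m U^T = 1%:M) ->
    mu.-negligible [set x | exists2 U, U \in s & A (x *m U)].
  elim: s => [|U s IH] sO.
    by rewrite (_ : [set _ | _] = set0); [exact: negligible_set0|apply/seteqP; split=> x //= [? ]].
  apply: (@negligibleS _ _ _ mu ([set x : 'rV[R]_n | A (x *m U)] `|`
      [set x : 'rV[R]_n | exists2 U, U \in s & A (x *m U)])).
    move=> x /= [V]; rewrite in_cons => /predU1P[->|Vs] AV; first by left.
    by right; exists V.
  apply: negligibleU; last by apply: IH => V Vs; apply: sO; rewrite in_cons Vs orbT.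
  have UU : U *m U^T = 1%:M by apply: sO; rewrite mem_head.
  apply/negligibleP; last exact: (etrans (hmu.2 U UU A mA) muA).
  by rewrite -[X in measurable X]setTI; exact: measurable_mulmxr.
have : mu.-negligible S.
  have DO' U : U \in (finmap.enum_fset D) -> U *m U^T = 1%:M.
    by move=> UD; have := DO U UD; rewrite inE.
  apply: negligibleS (neg (finmap.enum_fset D) DO') => x Sx.
  have [U /= UD GU] := covD x Sx; exists U => //; split=> //.
  by apply/usphere_orthogonal => //; exact: DO'.
move/(negligibleP mu mS); have [mu1 _] := hmu => mu0.
have /eqP := etrans (esym mu1) mu0.
by rewrite onee_eq0.
Qed.

End divergence.

(** * Functions of degree zero *)

Section radial.
Context {R : realType} {n : nat}.
Implicit Types (f g G : 'rV[R]_n -> R) (x y v w Om : 'rV[R]_n).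
Local Notation S := (@usphere R n).

Lemma C1_grad_partialE g dg : C1_grad g dg -> C1_grad g (fun i => partial i g).
Proof.
by move=> Cg; apply: C1_grad_eq (Cg) => // i x x0; rewrite (C1_grad_partial i Cg).
Qed.

Lemma C2_onP g : C2_on [set x | x != 0] g <->
  C1_grad g (fun i => partial i g) /\
  forall j, C1_grad (partial j g) (fun i => partial i (partial j g)).
Proof.
split=> [[cg dg ddg]|[Cg Cdg]].
  split=> [x x0|j x x0].
    split=> [|i]; first exact: cg.
    by have [? ?] := dg i x x0; split=> //; exact: derivableP.
  split=> [|i]; first by have [] := dg j x x0.
  by have [? ?] := ddg i j x x0; split=> //; exact: derivableP.
split=> [x /Cg[]//|i x /Cg[_ /(_ i)[[? _] ?]]//|i j x /(Cdg j)[_ /(_ i)[[? _] ?]]//].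
Qed.

Lemma enormZ (a : R) x : 0 <= a -> enorm (a *: x) = a * enorm x.
Proof.
move=> a0; rewrite /enorm dotpZl dotpC dotpZl mulrA -expr2 sqrtrM ?sqr_ge0//.
by rewrite sqrtr_sqr ger0_norm.
Qed.

Lemma radial_extZ (T : Type) (f : 'rV[R]_n -> T) (a : R) x : 0 < a ->
  radial_ext f (a *: x) = radial_ext f x.
Proof.
move=> a0; rewrite /radial_ext enormZ ?ltW// scalerA invfM mulrAC mulVf ?mul1r//.
by rewrite gt_eqF.
Qed.

Lemma radial_ext_usphere (T : Type) (f : 'rV[R]_n -> T) w : S w -> radial_ext f w = f w.
Proof. by move=> Sw; rewrite /radial_ext (_ : enorm w = 1)// invr1 scale1r. Qed.

Lemma normalize_usphere x : x != 0 -> S ((enorm x)^-1 *: x).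
Proof.
move=> x0; rewrite /usphere /= enormZ ?invr_ge0 ?enorm_ge0//.
by rewrite mulVf// enorm_neq0.
Qed.

(** Both sides compute the derivative at t = 0 of G((1 + t) x), which is constant as long as 1 + t
    stays positive. *)
Lemma euler_degree0 G dG x : C1_grad G dG ->
  (forall a y, 0 < a -> G (a *: y) = G y) -> x != 0 ->
  \sum_i x 0 i * dG i x = 0.
Proof.
move=> CG hG x0.
have D : is_derive (0 : R) (1 : R) (fun t : R => G ((1 + t) *: x)) (\sum_i x 0 i * dG i x).
  apply: is_derive_eq; last first.
    by under eq_bigr do rewrite -[X in dG _ X]scale1r -[X in dG _ (X *: _)]addr0.
  apply: (@C1_grad_is_derive_curve R n G dG (fun t => (1 + t) *: x)) => //.
    by rewrite addr0 scale1r.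
  move=> i; rewrite (_ : (fun _ => _) = fun t => (1 + t) * x 0 i); last first.
    by apply/funext => t; rewrite mxE.
  by apply: is_derive_eq; rewrite add0r scaler0 add0r [_ *: _]mulr1.
have D0 : is_derive (0 : R) (1 : R) (fun t : R => G ((1 + t) *: x)) 0.
  apply: near_eq_is_derive (is_derive_cst (G x : R^o) (0 : R^o) (1 : R^o)).
  near=> t; rewrite hG// -ltrBlDl sub0r; near: t.
  by apply: lt_nbhsr; rewrite ltrN10.
by rewrite -(@derive_val _ _ _ _ _ _ _ D) (@derive_val _ _ _ _ _ _ _ D0).
Unshelve. all: by end_near. Qed.

(** The gradient of a function of degree 0 has degree -1; this carries information on the gradient
    from the sphere to the whole punctured space. *)
Lemma grad_degree0 G dG (a : R) x i : C1_grad G dG ->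
  (forall a y, 0 < a -> G (a *: y) = G y) -> 0 < a -> x != 0 ->
  dG i x = a * dG i (a *: x).
Proof.
move=> CG hG a0 x0.
have D : is_derive (0 : R) (1 : R) (fun t : R => G (a *: (t *: delta_mx 0 i + x)))
    (a * dG i (a *: x)).
  apply: is_derive_eq.
    apply: (@C1_grad_is_derive_curve R n G dG (fun t => a *: (t *: delta_mx 0 i + x))
      (a *: delta_mx 0 i)) => //.
      by rewrite scale0r add0r scaler_eq0 negb_or gt_eqF.
    move=> k; rewrite (_ : (fun _ => _) =
        fun t => a * (t * (delta_mx 0 i : 'rV[R]_n) 0 k + x 0 k)); last first.
      by apply/funext => t; rewrite !mxE.
    by apply: is_derive_eq; rewrite !(scaler0, addr0, add0r) !mxE [_%:A]mulr1.
  rewrite /= scale0r add0r (bigD1 i)//= !mxE !eqxx /= mulr1 big1 ?addr0// => k ki.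
  by rewrite !mxE eqxx /= (negbTE ki) mulr0 mul0r.
rewrite -(@derive_val _ _ _ _ _ _ _ D).
under eq_fun do rewrite hG//.
have [_ /(_ i)[/is_derive_line[_ <-] _]] := CG x x0.
by [].
Qed.

(** For n >= 2 the punctured space is connected by axis-parallel segments: with one nonzero
    coordinate a kept fixed, all others are moved to 1, and then a itself is moved, another
    coordinate now being 1. Every point is thus joined to the all-ones vector without meeting 0. *)
Lemma grad0_constant G : (2 <= n)%N -> C1_grad G (fun _ _ => 0) ->
  forall x y, x != 0 -> y != 0 -> G x = G y.
Proof.
move=> n2 CG.
have axis i x (t : R) : (forall s : R, s *: delta_mx 0 i + x != 0) ->
    G (t *: delta_mx 0 i + x) = G x.
  move=> sx; apply/eqP; rewrite -subr_eq0 -normr_le0.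
  have := @mean_value_ineq R (fun s => G (s *: delta_mx 0 i + x)) (fun=> 0) t 0.
  rewrite scale0r add0r mul0r; apply=> s _; last by rewrite normr0.
  by apply: is_derive_affine; have [_ /(_ i)[]] := CG _ (sx s).
have rowE i x (t : R) : \row_k (if k == i then t else x 0 k) =
    (t - x 0 i) *: delta_mx 0 i + x.
  apply/rowP => k; rewrite !mxE eqxx /=; have [->|_] := eqVneq k i.
    by rewrite mulr1 subrK.
  by rewrite mulr0 add0r.
have setc i a x (t : R) : a != i -> x 0 a != 0 ->
    G (\row_k (if k == i then t else x 0 k)) = G x.
  move=> ai xa; rewrite rowE axis// => s; apply: contraNneq xa => /rowP /(_ a).
  by rewrite !mxE eqxx /= (negbTE ai) mulr0 add0r => ->.
have seta a x (s : seq 'I_n) : x 0 a != 0 -> a \notin s ->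
    G (\row_k (if k \in s then 1 else x 0 k)) = G x.
  move=> xa; elim: s => [|i s IH] /=.
    by move=> _; congr G; apply/rowP => k; rewrite mxE.
  rewrite in_cons negb_or => /andP[ai as_]; rewrite -(IH as_).
  rewrite -(setc i a (\row_k (if k \in s then 1 else x 0 k)) 1)//; last first.
    by rewrite mxE (negbTE as_).
  congr G; apply/rowP => k; rewrite !mxE in_cons.
  by have [->|_] := eqVneq k i.
suff H x : x != 0 -> G x = G (const_mx 1) by move=> x y /H -> /H ->.
move=> x0; have [a xa] : exists a, x 0 a != 0.
  apply: contrapT => /forallNP xa; move/eqP: x0; apply; apply/rowP => a.
  by rewrite mxE; apply/eqP/negPn/negP; exact: xa.
have [b ba] : exists b : 'I_n, b != a.
  case: n n2 a {x0 xa} => [//|[//|m]] _ a.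
  by have [->|a0] := eqVneq a ord0; [exists ord_max|exists ord0; rewrite eq_sym].
rewrite -(seta a x [seq k <- enum 'I_n | k != a])//; last by rewrite mem_filter eqxx.
rewrite -(setc a b _ 1)//; last first.
  by rewrite mxE mem_filter ba mem_enum /= oner_eq0.
congr G; apply/rowP => k; rewrite !mxE mem_filter mem_enum andbT.
by case: ifP => // ->.
Qed.
End radial.

(** * Stationary drift-diffusion on the sphere *)

Section drift_diffusion.
Context {R : realType} {n : nat}.
Implicit Types (f g G : 'rV[R]_n -> R) (x y v w Om : 'rV[R]_n).
Local Notation S := (@usphere R n).

(* The degree-zero extension of the tangential projection of Om. *)
Definition tangent_comp Om (j : 'I_n) x : R :=
  Om 0 j - dotp Om x * x 0 j * (enorm x)^-1 ^+ 2.

Definition drift_div f Om w := sphere_div (fun v => f v *: (Om *m Pperp v)) w.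

Lemma C1_grad_tangent_comp Om : exists dT, forall j, C1_grad (tangent_comp Om j) (dT j).
Proof.
have H j := C1_gradB (C1_grad_cst (Om 0 j)) (C1_gradM (C1_gradM (C1_grad_dotpl Om)
  (C1_grad_coord j)) (C1_gradM (@C1_grad_enormV R n) (@C1_grad_enormV R n))).
by eexists => j; exact: H.
Qed.

Lemma tangent_comp_orthogonal Om x : x != 0 -> \sum_j x 0 j * tangent_comp Om j x = 0.
Proof.
move=> x0; rewrite /tangent_comp; under eq_bigr do rewrite mulrBr.
rewrite sumrB -/(dotp x Om) dotpC.
rewrite (eq_bigr (fun j => dotp Om x * (enorm x)^-1 ^+ 2 * (x 0 j * x 0 j))); last first.
  by move=> j _; ring.
rewrite -mulr_sumr -/(dotp x x) -sqr_enorm exprVn -mulrA mulVf ?mulr1 ?subrr//.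
by rewrite expf_neq0// enorm_neq0.
Qed.

Lemma radial_ext_drift f Om x j :
  radial_ext (fun v => f v *: (Om *m Pperp v)) x 0 j =
  radial_ext f x * tangent_comp Om j x.
Proof.
rewrite /radial_ext mxE; congr (_ * _).
rewrite /Pperp mulmxBr mulmx1 /tangent_comp mxE [in X in _ + X]mxE; congr (_ - _).
rewrite mulmxA mxE big_ord1 !mxE.
rewrite (eq_bigr (fun k => (enorm x)^-1 * (Om 0 k * x 0 k))); last first.
  by move=> k _; rewrite !mxE; ring.
by rewrite -mulr_sumr -/(dotp Om x); ring.
Qed.

Lemma drift_divE f Om w D : (forall j, C1_grad (fun x => radial_ext f x * tangent_comp Om j x) (D j)) ->
  S w -> drift_div f Om w = \sum_j D j j w.
Proof.
move=> CD Sw; apply: eq_bigr => j _.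
rewrite -(C1_grad_partial j (CD j) (usphere_neq0 Sw)).
by congr (partial j _ w); apply/funext => x; exact: radial_ext_drift.
Qed.

(** The degree-zero extension of w -> w.Om. *)
Definition cosine Om x := dotp Om x * (enorm x)^-1.

Lemma C1_grad_cosine Om :
  C1_grad (cosine Om) (fun j x => tangent_comp Om j x * (enorm x)^-1).
Proof.
apply: C1_grad_eq (C1_gradM (C1_grad_dotpl Om) (@C1_grad_enormV R n)) => // j x _.
by rewrite /tangent_comp; ring.
Qed.

Lemma cosine_usphere Om w : S w -> cosine Om w = dotp w Om.
Proof. by move=> Sw; rewrite /cosine (_ : enorm w = 1)// invr1 mulr1 dotpC. Qed.

(** For this profile grad F = kappa F T / |x|, with T the tangential part of Om, so on the sphere
    diffusion and drift have the same flux. Differentiating the factor 1/|x| adds only a multiple of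
    the radial component of T, which is zero. *)
Lemma vonMises_solves f Om (kappa C : R) :
  (forall w, S w -> f w = C * expR (kappa * dotp w Om)) ->
  C2_sphere f /\ forall w, S w -> sphere_lap f w = kappa * drift_div f Om w.
Proof.
move=> fE; pose F := radial_ext f.
have FE x : x != 0 -> F x = C * expR (kappa * cosine Om x).
  move=> x0; rewrite /F /radial_ext fE; last exact: normalize_usphere.
  by rewrite dotpZl dotpC /cosine [_^-1 * _]mulrC.
pose dF j x := kappa * (F x * tangent_comp Om j x * (enorm x)^-1).
have CF : C1_grad F dF.
  apply: C1_grad_eq (C1_gradZ C (C1_grad_expR (C1_gradZ kappa (C1_grad_cosine Om)))).
    by move=> x x0; rewrite FE.
  by move=> j x x0; rewrite /dF FE//; ring.
have [dT CT] := C1_grad_tangent_comp Om.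
pose CFT j := C1_gradM CF (CT j).
pose CdF j := C1_gradZ kappa (C1_gradM (CFT j) (@C1_grad_enormV R n)).
have CpF j := C1_grad_eq (fun x hx => esym (C1_grad_partial j CF hx)) (fun _ _ _ => erefl) (CdF j).
split.
  by apply/C2_onP; split=> [|j]; [exact: C1_grad_partialE CF|exact: C1_grad_partialE (CpF j)].
move=> w Sw; have w0 := usphere_neq0 Sw.
rewrite (drift_divE (CFT) Sw) /sphere_lap.
under eq_bigr do rewrite (C1_grad_partial _ (CpF _) w0).
rewrite -mulr_sumr; congr (_ * _).
rewrite (_ : enorm w = 1)// invr1 expr1n big_split /=.
under [X in _ + X]eq_bigr do rewrite mul1r.
rewrite [X in X + _](eq_bigr (fun j => - F w * (w 0 j * tangent_comp Om j w))); last first.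
  by move=> j _; ring.
by rewrite -mulr_sumr tangent_comp_orthogonal// mulr0 add0r.
Qed.

Context (mu : probability (borelRV R n) R) (hmu : uniform_on_sphere mu).

(* Energy method: with F, s the degree-zero extensions of f and w.Om, the field
   V = F e^(- kappa s) (|x| grad F - kappa F T) is tangent and its divergence on
   the sphere is e^(- kappa s) | |x| grad F - kappa F T |^2. *)
Lemma drift_diffusion_stationary f Om (kappa : R) : (2 <= n)%N -> C2_sphere f ->
  (forall w, S w -> sphere_lap f w = kappa * drift_div f Om w) ->
  exists C, forall w, S w -> f w = C * expR (kappa * dotp w Om).
Proof.
move=> n2 /C2_onP; pose F := radial_ext f; rewrite -/F => -[CF CdF] eqf.
have [dT CT] := C1_grad_tangent_comp Om.
pose CFT j := C1_gradM CF (CT j).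
pose A j x := enorm x * partial j F x - kappa * (F x * tangent_comp Om j x).
pose CA j := C1_gradB (C1_gradM (@C1_grad_enorm R n) (CdF j)) (C1_gradZ kappa (CFT j)).
pose E x := expR (- kappa * cosine Om x).
pose G x := F x * E x.
pose dG j x := E x * (enorm x)^-1 * A j x.
have CG : C1_grad G dG.
  apply: C1_grad_eq (C1_gradM CF (C1_grad_expR (C1_gradZ (- kappa) (C1_grad_cosine Om)))) => //.
  by move=> j x x0; rewrite /dG /A /E; field; exact: enorm_neq0.
pose CV j := C1_gradM CG (CA j).
have eulerF x : x != 0 -> \sum_j x 0 j * partial j F x = 0.
  by move=> x0; apply: (euler_degree0 CF _ x0) => a y; exact: radial_extZ.
have tA x : x != 0 -> \sum_j x 0 j * A j x = 0.
  move=> x0; rewrite (eq_bigr (fun j => enorm x * (x 0 j * partial j F x)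
      - kappa * F x * (x 0 j * tangent_comp Om j x))); last by move=> j _; rewrite /A; ring.
  by rewrite sumrB -!mulr_sumr eulerF// tangent_comp_orthogonal// !mulr0 subr0.
have tV x : x != 0 -> \sum_j x 0 j * (G x * A j x) = 0.
  move=> x0; rewrite (eq_bigr (fun j => G x * (x 0 j * A j x))); last by move=> j _; ring.
  by rewrite -mulr_sumr tA// mulr0.
have cE : cont_off0 E by apply: C1_grad_cont_off0 (C1_grad_expR (C1_gradZ (- kappa) (C1_grad_cosine Om))).
have cA j : cont_off0 (A j) := C1_grad_cont_off0 (CA j).
have cW : cont_off0 (fun w => E w * \sum_j A j w ^+ 2).
  by apply: cont_off0M => //; apply: cont_off0_sum => j; exact: cont_off0X.
(* The divergence of G A is grad G . A + G div A. On the sphere div A is the Laplacian plus the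
   radial derivative minus kappa times the drift, hence 0 by Euler's identity and the equation,
   while grad G = E A. *)
have int0 : \int[mu]_(w in S) (E w * \sum_j A j w ^+ 2) = 0.
  rewrite -[RHS](tangent_divergence hmu CV tV); apply: eq_sphere_int => w Sw.
  have w0 := usphere_neq0 Sw; have w1 : enorm w = 1 by [].
  rewrite big_split /= -mulr_sumr sumrB big_split /= w1.
  under [X in G w * (X + _ - _)]eq_bigr do rewrite mul1r.
  rewrite -mulr_sumr -(drift_divE CFT Sw) -/(sphere_lap f w) eqf//.
  under [X in G w * (_ + X - _)]eq_bigr do rewrite divr1 mulrC.
  rewrite eulerF// addr0 subrr mulr0 add0r. rewrite mulr_sumr; apply: eq_bigr => j _.
  by rewrite /dG /A w1 invr1; ring.
have A0 j w : S w -> A j w = 0.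
  move=> Sw; have := sphere_int_ge0_eq0 hmu cW _ int0 Sw.
  have Ege0 v : 0 < E v by exact: expR_gt0.
  have sge0 v : 0 <= \sum_j A j v ^+ 2 by apply: sumr_ge0 => k _; exact: sqr_ge0.
  move=> /(_ _)/eqP; rewrite mulf_eq0 gt_eqF//=.
  rewrite psumr_eq0 => [|k _]; last exact: sqr_ge0.
  move=> H; apply/eqP; rewrite -sqrf_eq0.
  by apply: (allP (H _) j (mem_index_enum j)) => v _; rewrite mulr_ge0// ltW.
have hG (a : R) y : 0 < a -> G (a *: y) = G y.
  move=> a0; rewrite /G /E /F radial_extZ//; congr (_ * expR (_ * _)).
  rewrite /cosine enormZ ?ltW// [dotp Om _]dotpC dotpZl dotpC invfM.
  by rewrite mulrACA mulfV ?mul1r// gt_eqF.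
(* A vanishes so far on the sphere only; homogeneity of the gradient of G extends this to all x !=
   0. *)
have CG0 : C1_grad G (fun _ _ => 0).
  apply: C1_grad_eq (CG) => // j x x0.
  rewrite (@grad_degree0 _ _ _ _ (enorm x)^-1 _ _ CG)//; last by rewrite invr_gt0 enorm_gt0.
  by rewrite /dG A0 ?mulr0//; exact: normalize_usphere.
have n0 : (0 < n)%N by exact: ltnW.
pose e : 'rV[R]_n := delta_mx 0 (Ordinal n0).
have e0 : e != 0.
  by apply/negP => /eqP /rowP /(_ (Ordinal n0)) /eqP; rewrite !mxE !eqxx oner_eq0.
exists (G e) => w Sw.
rewrite (grad0_constant n2 CG0 e0 (usphere_neq0 Sw)) /G /E /F radial_ext_usphere//.
by rewrite cosine_usphere// -mulrA -expRD mulNr addNr expR0 mulr1.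
Qed.
End drift_diffusion.

(** * Moments of the cosine *)

Section moments.
Context {R : realType}.
Local Notation lam := (@lebesgue_measure R).

Lemma expr_continuous (f : R -> R) k : continuous f -> continuous (fun t => f t ^+ k).
Proof.
move=> cf t; apply: (@continuous_comp _ _ _ f (fun x => x ^+ k)); first exact: cf.
exact: exprn_continuous.
Qed.

Lemma continuous_funM (f g : R -> R) : continuous f -> continuous g ->
  continuous (fun t => f t * g t).
Proof. by move=> cf cg t; apply: cvgM; [exact: cf|exact: cg]. Qed.

Lemma continuous_funZ (a : R) (f : R -> R) : continuous f -> continuous (fun t => a * f t).
Proof. by apply: continuous_funM; exact: cst_continuous. Qed.

Lemma continuous_funN (f : R -> R) : continuous f -> continuous (fun t => - f t).
Proof. by move=> cf t; apply: cvgN; exact: cf. Qed.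

Lemma continuous_funD (f g : R -> R) : continuous f -> continuous g ->
  continuous (fun t => f t + g t).
Proof. by move=> cf cg t; apply: cvgD; [exact: cf|exact: cg]. Qed.

Lemma measure_segment_fin (a b : R) : (lam `[a, b]%classic < +oo)%E.
Proof. by rewrite lebesgue_measure_itv /=; case: ifP => // _; rewrite -EFinB ltry. Qed.

Lemma segment_integrable (f : R -> R) (a b : R) : continuous f ->
  lam.-integrable `[a, b]%classic (EFin \o f).
Proof.
move=> cf; apply: (@continuous_compact_integrable R (f : R -> R^o)).
  exact: segment_compact.
exact: continuous_subspaceT.
Qed.

Definition moment m k (kappa : R) : R :=
  \int[lam]_(t in `[0, pi]%classic) (cos t ^+ k * expR (kappa * cos t) * sin t ^+ m).

Lemma moment_integrand_continuous m k (kappa : R) :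
  continuous (fun t : R => cos t ^+ k * expR (kappa * cos t) * sin t ^+ m).
Proof.
apply: continuous_funM; last by apply: expr_continuous; exact: continuous_sin.
apply: continuous_funM; first by apply: expr_continuous; exact: continuous_cos.
move=> t; apply: (@continuous_comp _ _ _ (fun t => kappa * cos t) expR); last exact: continuous_expR.
by apply: continuous_funZ; exact: continuous_cos.
Qed.

Lemma moment_integrable m k kappa : lam.-integrable `[0, pi]%classic
  (EFin \o (fun t : R => cos t ^+ k * expR (kappa * cos t) * sin t ^+ m)).
Proof. by apply: segment_integrable; exact: moment_integrand_continuous. Qed.

Lemma Rintegral_FTC2 (f F : R -> R) (a b : R) : a < b -> continuous f ->
  (forall t, is_derive t (1 : R) F (f t)) ->
  \int[lam]_(t in `[a, b]%classic) f t = F b - F a.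
Proof.
move=> ab cf DF; rewrite /Rintegral (@continuous_FTC2 _ f F)//.
- exact: continuous_subspaceT.
- have cF t : {for t, continuous F}.
    by apply/differentiable_continuous/derivable1_diffP; case: (DF t).
  split=> [t _||]; first by case: (DF t).
  + by apply: cvg_at_right_filter; exact: cF.
  + by apply: cvg_at_left_filter; exact: cF.
- by move=> t _; rewrite derive1E; apply: derive_val.
Qed.

Lemma is_derive_exprn k (x : R) : is_derive x (1 : R) (fun t => t ^+ k) (k%:R * x ^+ k.-1).
Proof.
split; first exact: exprn_derivable.
by rewrite exp_derive [_%:A]mulr1.
Qed.

(** Integration of the derivative of cos^k e^(kappa cos) sin^(m+1), which vanishes at 0 and pi, with
    sin^2 = 1 - cos^2. For k = 0 the truncated index [k.-1] is harmless, being multiplied by k. *)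
Lemma moment_recl m k (kappa : R) :
  m.+1%:R * moment m k.+1 kappa =
  k%:R * (moment m k.-1 kappa - moment m k.+1 kappa) +
  kappa * (moment m k kappa - moment m k.+2 kappa).
Proof.
pose h i (t : R) := cos t ^+ i * expR (kappa * cos t) * sin t ^+ m.
have ch i : continuous (h i) by exact: moment_integrand_continuous.
have ih i : lam.-integrable `[0, pi]%classic (EFin \o h i) by exact: moment_integrable.
pose g t := m.+1%:R * h k.+1 t + (- (k%:R * (h k.-1 t - h k.+1 t)) + - (kappa * (h k t - h k.+2 t))).
have cB i j : continuous (fun t => h i t - h j t) by apply: continuous_funD => //; exact: continuous_funN.
have cZ (a : R) i : continuous (fun t => a * h i t) by exact: continuous_funZ.
have cZB (a : R) i j : continuous (fun t => a * (h i t - h j t)) by exact: continuous_funZ.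
have cAB : continuous (fun t => m.+1%:R * h k.+1 t - k%:R * (h k.-1 t - h k.+1 t)).
  by apply: continuous_funD; [exact: continuous_funZ|apply: continuous_funN; exact: continuous_funZ].
have cg : continuous g.
  by apply: continuous_funD; [exact: continuous_funZ|apply: continuous_funD; apply: continuous_funN; exact: continuous_funZ].
have Eg : \int[lam]_(t in `[0, pi]%classic) g t = 0.
  have DF (t : R) : is_derive t (1 : R)
      (fun t => cos t ^+ k * expR (kappa * cos t) * sin t ^+ m.+1) (g t).
    have Dc : is_derive t (1 : R) (fun s => cos s ^+ k) (k%:R * cos t ^+ k.-1 * - sin t).
      exact: (is_derive1_comp (is_derive_exprn k (cos t)) (is_derive_cos t)).
    have Ds : is_derive t (1 : R) (fun s => sin s ^+ m.+1) (m.+1%:R * sin t ^+ m * cos t).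
      exact: (is_derive1_comp (is_derive_exprn m.+1 (sin t)) (is_derive_sin t)).
    have De : is_derive t (1 : R) (fun s => expR (kappa * cos s))
        (expR (kappa * cos t) * (kappa * - sin t)).
      have Dk : is_derive t (1 : R) (fun s => kappa * cos s) (kappa * - sin t).
        exact: (is_deriveZ kappa (is_derive_cos t)).
      exact (@is_derive1_comp R expR (fun s => kappa * cos s) t _ _ (is_derive_expR (kappa * cos t)) Dk).
    have := is_deriveM (is_deriveM Dc De) Ds.
    move=> D; refine (is_derive_eq D _).
    rewrite /g /h /GRing.scale /=.
    rewrite fctE; have := cos2Dsin2 t; set e := expR (kappa * cos t).
    move: e (cos t) (sin t) => e c s cs; have s2 : s ^+ 2 = 1 - c ^+ 2 by rewrite -cs; ring.
    by case: (k) => [|k'] /=; rewrite !exprS; ring: s2.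
  have := Rintegral_FTC2 (pi_gt0 R) cg DF.
  by rewrite sinpi sin0 !expr0n /= !mulr0 subrr.
have mI : measurable (`[0, pi]%classic : set R) by [].
have iZ (a : R) (f : R -> R) : lam.-integrable `[0, pi]%classic (EFin \o f) ->
    lam.-integrable `[0, pi]%classic (EFin \o (fun t => a * f t)).
  by move=> fi; exact: (@integrableZl _ _ _ lam _ mI a (EFin \o f) fi).
have iB i j : lam.-integrable `[0, pi]%classic (EFin \o (fun t => h i t - h j t)).
  by apply: segment_integrable; apply: continuous_funD => //; exact: continuous_funN.
have Eh i j : \int[lam]_(t in `[0, pi]%classic) (h i t - h j t) =
    moment m i kappa - moment m j kappa by rewrite RintegralB.
have : m.+1%:R * moment m k.+1 kappa - k%:R * (moment m k.-1 kappa - moment m k.+1 kappa)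
  - kappa * (moment m k kappa - moment m k.+2 kappa) = 0.
  rewrite -!Eh -!RintegralZl//; last exact: ih.
  rewrite -!RintegralB//.
  - by rewrite -[RHS]Eg; apply: eq_Rintegral => t _; rewrite /g /h; ring.
  - exact: (segment_integrable 0 pi cAB).
  - by apply: segment_integrable; exact: cZB.
  - by apply: segment_integrable; exact: cZ.
  - by apply: segment_integrable; exact: cZB.
by move=> H; apply/eqP; rewrite -subr_eq0 -[X in _ == X]H; apply/eqP; ring.
Qed.

Lemma moment_sin m k (kappa : R) :
  moment m.+2 k kappa = moment m k kappa - moment m k.+2 kappa.
Proof.
rewrite /moment -RintegralB//; try exact: moment_integrable.
apply: eq_Rintegral => t _; have := cos2Dsin2 t.
set e := expR _; move: e (cos t) (sin t) => e c s cs.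
have s2 : s ^+ 2 = 1 - c ^+ 2 by rewrite -cs; ring.
by rewrite !exprS; ring: s2.
Qed.

Lemma moment0_1 m : m.+2%:R * moment m 2 0 = moment m 0 0 :> R.
Proof.
have := moment_recl m 1 0; rewrite mul1r mul0r addr0 /= => H.
by rewrite -natr1 mulrDl H; ring.
Qed.

(** Wallis recursion: raising m by 2 multiplies the integral by (m+1)/(m+2), so the induction keeps
    two consecutive values; the base integrals are pi and 2. *)
Lemma moment00_gt0 m : 0 < moment m 0 (0 : R).
Proof.
have [] : 0 < moment m 0 (0 : R) /\ 0 < moment m.+1 0 (0 : R); last by [].
elim: m => [|m [m0 m1]].
  split.
    have -> : moment 0 0 0 = \int[lam]_(t in `[0, pi]%classic) (1 : R).
      by apply: eq_Rintegral => t _; rewrite mul0r expR0 !mulr1.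
    rewrite (@Rintegral_FTC2 (fun=> 1) id)//; first by rewrite subr0 pi_gt0.
      exact: pi_gt0.
    exact: cst_continuous.
  have -> : moment 1 0 0 = \int[lam]_(t in `[0, pi]%classic) (sin t : R).
    by apply: eq_Rintegral => t _; rewrite mul0r expR0 !mul1r.
  have D (t : R) : is_derive t (1 : R) (fun t => - cos t) (sin t).
    by have := is_deriveN (is_derive_cos t); rewrite opprK.
  rewrite (Rintegral_FTC2 (pi_gt0 R) (@continuous_sin R) D).
  by rewrite cospi cos0; lra.
split=> //; rewrite moment_sin -(moment0_1 m) -{2}[moment m 2 0]mul1r -mulrBl.
have : 0 < m.+2%:R * moment m 2 (0 : R) by rewrite moment0_1.
by rewrite pmulr_rgt0// => H; rewrite mulr_gt0// subr_gt0 ltr1n.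
Qed.

(** The bound e^(kappa cos t) >= e^(-|kappa|) reduces the claim to kappa = 0. *)
Lemma moment0_gt0 m (kappa : R) : 0 < moment m 0 kappa.
Proof.
apply: (@lt_le_trans _ _ (expR (- `|kappa|) * moment m 0 0)).
  by rewrite mulr_gt0 ?expR_gt0// moment00_gt0.
rewrite /moment -RintegralZl//; last exact: moment_integrable.
apply: le_Rintegral => //.
- apply: segment_integrable; apply: continuous_funZ; exact: moment_integrand_continuous.
- exact: moment_integrable.
move=> t /=; rewrite in_itv /= => /andP[t0 tpi].
rewrite mul0r expR0 !mul1r ler_wpM2r//; first by rewrite exprn_ge0// sin_ge0_pi// t0.
rewrite ler_expR; have : `|kappa * cos t| <= `|kappa|.
  by rewrite normrM ler_piMr// ler_norml cos_geN1 cos_le1.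
by rewrite ler_norml => /andP[].
Qed.

Lemma moment_continuous m k : continuous (moment m k : R -> R).
Proof.
move=> kappa.
have H := @continuity_under_integral R _ _ lam
  (fun kappa t => cos t ^+ k * expR (kappa * cos t) * sin t ^+ m) `[0, pi]%classic.
(* On the window of radius 1 around kappa every exponent is at most |kappa| + 1, which gives a
   constant dominating function. *)
apply: (H _ (kappa - 1) (kappa + 1) _ _ (fun=> expR (`|kappa| + 1))) => //.
- by move=> x _; exact: moment_integrable.
- apply: aeW => t _ x _; apply: continuous_funM; last exact: cst_continuous.
  apply: continuous_funM; first exact: cst_continuous.
  move=> y; apply: (@continuous_comp _ _ _ (fun z : R => z * cos t) expR); last exact: continuous_expR.
  by apply: continuous_funM; [move=> ?; exact: cvg_id|exact: cst_continuous].
- by apply: segment_integrable; exact: cst_continuous.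
- move=> x; rewrite /= in_itv/= => xk; apply: aeW => t _.
  have ct : `|cos t| <= 1 by rewrite ler_norml cos_geN1 cos_le1.
  have st : `|sin t| <= 1 by rewrite ler_norml sin_geN1 sin_le1.
  rewrite !normrM !normrX (ger0_norm (expR_ge0 _)).
  rewrite -[leRHS]mulr1 ler_pM ?mulr_ge0 ?expR_ge0 ?exprn_ge0 ?exprn_ile1//.
  rewrite -[leRHS]mul1r ler_pM ?mulr_ge0 ?expR_ge0 ?exprn_ge0 ?exprn_ile1//.
  rewrite ler_expR (le_trans (ler_norm _))// normrM.
  rewrite -[leRHS]mulr1 ler_pM//.
  have : `|x - kappa| <= 1 by rewrite ler_norml; lra.
  by move=> H1; have := ler_normD (x - kappa) kappa; rewrite subrK; lra.
- by rewrite inE/= in_itv/=; lra.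
Qed.
End moments.

(** * Moments on the sphere against moments of the cosine *)

Section sphere_moments.
Context {R : realType}.

(** Termwise integration of the exponential series, with partial sums bounded by e^|kappa|. The
    measure and the weight are left general so that it applies both to the sphere and to sin^(n-2)
    dt: integrals for any kappa are then determined by the moments at kappa = 0. *)
Lemma exp_moment_series d (T : measurableType d) (mu : {measure set T -> \bar R})
    (D : set T) (s wt : T -> R) (kappa : R) (p : nat) :
  measurable D -> (mu D < +oo)%E -> measurable_fun D s -> measurable_fun D wt ->
  (forall x, D x -> `|s x| <= 1) -> (forall x, D x -> `|wt x| <= 1) ->
  \sum_(0 <= k < N) (kappa ^+ k / k`!%:R * \int[mu]_(x in D) (s x ^+ (k + p) * wt x))
    @[N --> \oo] --> \int[mu]_(x in D) (s x ^+ p * expR (kappa * s x) * wt x).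
Proof.
move=> mD muD ms mwt s1 wt1.
have mX k : measurable_fun D (fun x => s x ^+ k * wt x).
  by apply: measurable_funM => //; exact: measurable_funX.
have iX k : mu.-integrable D (EFin \o (fun x => s x ^+ k * wt x)).
  apply: measurable_bounded_integrable => //; exists 1; split=> [|M M1 x Dx /=].
    exact: num_real.
  apply: (@le_trans _ _ 1); last exact: ltW.
  by rewrite normrM normrX -[leRHS]mulr1 ler_pM ?exprn_ge0 ?exprn_ile1 ?s1 ?wt1.
pose f N x := \sum_(0 <= k < N) (kappa ^+ k / k`!%:R * (s x ^+ (k + p) * wt x)).
have iZ (a : R) k : mu.-integrable D (EFin \o (fun x => a * (s x ^+ k * wt x))).
  exact: (@integrableZl _ _ _ mu _ mD a _ (iX k)).
have if_ N : mu.-integrable D (EFin \o f N).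
  rewrite /f; elim: N => [|N IH].
    apply: (eq_integrable mD (cst 0%E)); last exact: integrable0.
    by move=> x _; rewrite /= big_nil.
  apply: (eq_integrable mD (fun x => (f N x)%:E + (kappa ^+ N / N`!%:R * (s x ^+ (N + p) * wt x))%:E)%E).
    by move=> x _; rewrite /= big_nat_recr.
  exact: (integrableD mD IH (iZ _ _)).
have Ef N : \int[mu]_(x in D) f N x =
    \sum_(0 <= k < N) (kappa ^+ k / k`!%:R * \int[mu]_(x in D) (s x ^+ (k + p) * wt x)).
  elim: N => [|N IH].
    rewrite big_nil /f; under eq_Rintegral do rewrite big_nil.
    by rewrite Rintegral_cst// mul0r.
  rewrite big_nat_recr//= -IH -RintegralZl// -RintegralD//.
  by apply: eq_Rintegral => x _; rewrite /f big_nat_recr.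
under eq_fun do rewrite -Ef.
have fE N x : f N x = series (exp_coeff (kappa * s x)) N * (s x ^+ p * wt x).
  rewrite /f /series /= mulr_suml; apply: eq_bigr => k _.
  by rewrite /exp_coeff /= exprMn exprD; ring.
apply: (@Rintegral_bounded_cvg _ _ _ _ _ _ _ (expR `|kappa|)) => //.
- by move=> N; have /measurable_int /measurable_EFinP := if_ N.
- move=> x Dx; under eq_fun do rewrite fE.
  rewrite (_ : _ * wt x = expR (kappa * s x) * (s x ^+ p * wt x)); last by ring.
  by apply: cvgM; [exact: is_cvg_series_exp_coeff|exact: cvg_cst].
- move=> N x Dx; rewrite fE normrM -[leRHS]mulr1 ler_pM//; last first.
    by rewrite normrM normrX -[leRHS]mulr1 ler_pM ?exprn_ge0 ?exprn_ile1 ?s1 ?wt1.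
  apply: (@le_trans _ _ (series (exp_coeff `|kappa|) N)).
    rewrite /series /=; apply: le_trans (ler_norm_sum _ _ _) _.
    apply: ler_sum => k _; rewrite normrM normfV normr_nat normrX.
    by rewrite ler_wpM2r// lerXn2r ?nnegrE// normrM ler_piMr// s1.
  apply: nondecreasing_cvgn_le; last exact: is_cvg_series_exp_coeff.
  apply/nondecreasing_seqP => k; rewrite /series /= big_nat_recr//= lerDl.
  by rewrite divr_ge0// exprn_ge0.
Qed.

Context {n : nat} (hn : (2 <= n)%N).
Context (mu : probability (borelRV R n) R) (hmu : uniform_on_sphere mu).
Local Notation S := (@usphere R n).
Local Notation "'E[' f ]" := (\int[mu]_(w in S) f w).
Implicit Types (w Om : 'rV[R]_n).

Lemma sphere_int_cst (a : R) : E[fun=> a] = a.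
Proof.
rewrite Rintegral_cst; last exact: measurable_usphere.
have [mu1 _] := hmu; rewrite -[RHS]mulr1; congr (_ * _).
exact: (congr1 fine mu1).
Qed.

Lemma C1_gradX (f : 'rV[R]_n -> R) df k : C1_grad f df ->
  C1_grad (fun x => f x ^+ k) (fun i x => k%:R * f x ^+ k.-1 * df i x).
Proof.
move=> Cf; refine (@C1_grad_comp _ _ (fun t => t ^+ k) (fun t => k%:R * t ^+ k.-1) _ _ Cf _) => x _.
split; first exact: is_derive_exprn.
by move: (f x); apply: continuous_funZ; apply: expr_continuous => t; exact: cvg_id.
Qed.

Let i0 : 'I_n := Ordinal (ltnW hn).

Lemma sphere_int_cosine (h : R -> R) Om : continuous h -> S Om ->
  E[fun w => h (dotp w Om)] = E[fun w => h (w 0 i0)].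
Proof.
move=> ch SOm; pose e : 'rV[R]_n := delta_mx 0 i0.
have dote w : dotp w e = w 0 i0.
  rewrite /dotp (bigD1 i0)//= mxE !eqxx mulr1 big1 ?addr0// => k ki.
  by rewrite mxE eqxx /= (negbTE ki) mulr0.
have Se : S e by apply/usphereE; rewrite dote mxE !eqxx.
have [U [UU OmU]] := usphere_transitive SOm Se.
rewrite -(sphere_int_orthogonal hmu UU (f := fun w => h (w 0 i0))); last first.
  by apply: cont_off0_comp => //; exact: cont_off0_coord.
apply: eq_sphere_int => w _; congr h.
by rewrite -dote dotp_mulmx -OmU -mulmxA UU mulmx1.
Qed.

Let m_ k := E[fun w => w 0 i0 ^+ k].

Let cX i k : cont_off0 (fun w : 'rV[R]_n => w 0 i ^+ k).
Proof. by apply: cont_off0X; exact: cont_off0_coord. Qed.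

(** For j different from [i0], the rotation generator of this plane applied to w_j w_i0^k shows that
    the moment of order k + 1 is k times the integral of w_j^2 w_i0^(k-1). Summing over the n - 1
    such j, the squares w_j^2 add up to 1 - w_i0^2. *)
Lemma sphere_moment_recl k : (n - 1)%:R * m_ k.+1 = k%:R * (m_ k.-1 - m_ k.+1).
Proof.
have H j : j != i0 -> m_ k.+1 = k%:R * E[fun w => w 0 j ^+ 2 * w 0 i0 ^+ k.-1].
  move=> ji; have ij : i0 != j by rewrite eq_sym.
  have := sphere_int_generator hmu ij
    (C1_gradM (C1_grad_coord j) (C1_gradX k (C1_grad_coord i0))).
  rewrite eqxx (negbTE ij) => H; apply/eqP; rewrite -subr_eq0 -H; apply/eqP.
  rewrite -sphere_intZ; last by apply: cont_off0M.
  rewrite -sphere_intB//; last first.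
    by apply: cont_off0M; [exact: cont_off0_cst|exact: cont_off0M].
  apply: eq_sphere_int => w _; rewrite eqxx (negbTE ji) exprS.
  move: (w 0 i0) (w 0 j) => a b; rewrite mulr1n mulr0n; ring.
have [j0 j0i] : exists j : 'I_n, j != i0.
  by exists (Ordinal hn).
case: k H => [|k] H /=; first by rewrite (H j0)// !mul0r mulr0.
have cs j : cont_off0 (fun w : 'rV[R]_n => w 0 j ^+ 2 * w 0 i0 ^+ k) by exact: cont_off0M.
have -> : m_ k - m_ k.+2 = \sum_(j < n | j != i0) E[fun w => w 0 j ^+ 2 * w 0 i0 ^+ k].
  apply/eqP; rewrite subr_eq addrC; apply/eqP.
  transitivity (\sum_j E[fun w => w 0 j ^+ 2 * w 0 i0 ^+ k]).
    rewrite -sphere_int_sum//; apply: eq_sphere_int => w Sw.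
    have w2 : \sum_j w 0 j ^+ 2 = 1.
      by rewrite -[RHS](dotp_usphere Sw); apply: eq_bigr => j _; rewrite expr2.
    by rewrite -mulr_suml w2 mul1r.
  by rewrite (bigD1 i0)//=; congr (_ + _); apply: eq_sphere_int => w _; rewrite -exprD.
rewrite mulr_sumr (eq_bigr (fun=> m_ k.+2)); last by move=> j ji; rewrite -(H j ji).
rewrite sumr_const -[RHS]mulr_natl; congr (_%:R * _).
have := cardC1 i0; rewrite card_ord subn1 => <-.
by apply: eq_card => j; rewrite !inE.
Qed.

(** Both sequences satisfy the same recursion of step two, whose coefficient has the nonzero
    denominator n - 1 + k. It makes the moments of order 1 vanish, and at order 0 the sphere has
    mass 1, so only the total integral of sin^(n-2) remains as a factor. *)
Lemma sphere_moment_eq k : moment (n - 2) k 0 = moment (n - 2) 0 0 * m_ k.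
Proof.
have n1 : (n - 2).+1 = (n - 1)%N by rewrite -subSn.
have rec (a : nat -> R) : (forall k, (n - 1)%:R * a k.+1 = k%:R * (a k.-1 - a k.+1)) ->
    forall k, a k.+1 = k%:R / (n - 1 + k)%:R * a k.-1.
  move=> Ha i; have d0 : (n - 1 + i)%:R != 0 :> R.
    by rewrite pnatr_eq0 addn_eq0 subn_eq0 leqNgt hn.
  have : (n - 1 + i)%:R * a i.+1 = i%:R * a i.-1 by rewrite natrD mulrDl Ha; ring.
  move: d0; move: (n - 1 + i)%:R => d d0 E; apply: (mulfI d0); rewrite E; field.
  by [].
have Hm := rec _ sphere_moment_recl.
have HI := rec (fun k => moment (n - 2) k 0) _.
have {}HI i : moment (n - 2) i.+1 0 = i%:R / (n - 1 + i)%:R * moment (n - 2) i.-1 (0 : R).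
  by apply: HI => l; have := moment_recl (n - 2) l (0 : R); rewrite mul0r addr0 n1.
have [] : moment (n - 2) k 0 = moment (n - 2) 0 0 * m_ k /\
    moment (n - 2) k.+1 0 = moment (n - 2) 0 0 * m_ k.+1; last by [].
elim: k => [|k [IH1 IH2]].
  rewrite HI Hm !mul0r mulr0; split=> //.
  by rewrite /m_ (_ : E[_] = 1) ?mulr1// -[RHS]sphere_int_cst; exact: eq_sphere_int.
by split=> //; rewrite HI Hm /= IH1; ring.
Qed.

(** This takes the place of the slicing formula: equality of the moments is summed through the
    exponential series on both sides. *)
Lemma sphere_exp_moment p (kappa : R) Om : S Om ->
  moment (n - 2) p kappa = moment (n - 2) 0 0 * E[fun w => dotp w Om ^+ p * expR (kappa * dotp w Om)].
Proof.
move=> SOm.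
rewrite (@sphere_int_cosine (fun t => t ^+ p * expR (kappa * t)))//; last first.
  apply: continuous_funM; first by apply: expr_continuous => t; exact: cvg_id.
  move=> t; apply: (@continuous_comp _ _ _ (fun t : R => kappa * t) expR); last exact: continuous_expR.
  by apply: continuous_funZ => x; exact: cvg_id.
have mS := @measurable_usphere R n.
have muS : (mu S < +oo)%E.
  by apply: le_lt_trans (probability_le1 mu mS) _; rewrite ltry.
have mi0 : measurable_fun (S : set (borelRV R n)) (fun w : 'rV[R]_n => w 0 i0).
  by apply: cont_off0_measurable; exact: cont_off0_coord.
have m1 : measurable_fun (S : set (borelRV R n)) (fun w : 'rV[R]_n => 1 : R).
  by apply: cont_off0_measurable; exact: cont_off0_cst.
have L1 := @exp_moment_series _ _ mu S (fun w => w 0 i0) (fun=> 1) kappa p mS muS mi0 m1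
  (fun w Sw => coord_usphere_le1 i0 Sw) (fun _ _ => eq_ind_r (fun z => z <= 1) (lexx 1) (normr1 R)).
have L2 := @exp_moment_series _ _ (@lebesgue_measure R) `[0, pi]%classic cos
  (fun t => sin t ^+ (n - 2)) kappa p.
have {}L2 : \sum_(0 <= k < N) (kappa ^+ k / k`!%:R * moment (n - 2) (k + p) 0)
    @[N --> \oo] --> moment (n - 2) p kappa.
  have E k : moment (n - 2) k 0 =
      \int[@lebesgue_measure R]_(x in `[0, pi]%classic) (cos x ^+ k * sin x ^+ (n - 2)).
    by apply: eq_Rintegral => t _; rewrite mul0r expR0 mulr1.
  rewrite (_ : (fun N => _) = fun N => \sum_(0 <= k < N) (kappa ^+ k / k`!%:R *
      \int[@lebesgue_measure R]_(x in `[0, pi]%classic)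
        (cos x ^+ (k + p) * sin x ^+ (n - 2)))); last first.
    by apply/funext => N; apply: eq_bigr => k _; rewrite E.
  apply: L2 => //.
  - exact: measure_segment_fin.
  - by apply: measurable_funTS; apply: continuous_measurable_fun; exact: continuous_cos.
  - apply: measurable_funTS; apply: continuous_measurable_fun.
    by apply: expr_continuous; exact: continuous_sin.
  - by move=> t _; rewrite ler_norml cos_geN1 cos_le1.
  - by move=> t _; rewrite normrX exprn_ile1// ler_norml sin_geN1 sin_le1.
have L3 : moment (n - 2) 0 (0 : R) * \sum_(0 <= k < N)
      (kappa ^+ k / k`!%:R * E[fun w => w 0 i0 ^+ (k + p) * 1]) @[N --> \oo] -->
    moment (n - 2) 0 (0 : R) * E[fun w => w 0 i0 ^+ p * expR (kappa * w 0 i0) * 1].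
  by apply: cvgM; [exact: cvg_cst|exact: L1].
have -> : E[fun w => w 0 i0 ^+ p * expR (kappa * w 0 i0)] =
    E[fun w => w 0 i0 ^+ p * expR (kappa * w 0 i0) * 1].
  by apply: eq_sphere_int => w _; rewrite mulr1.
rewrite -(cvg_lim (@Rhausdorff R) L2) -(cvg_lim (@Rhausdorff R) L3).
congr (limn _); apply/funext => N.
rewrite /= mulr_sumr; apply: eq_bigr => k _; rewrite sphere_moment_eq.
rewrite (_ : E[fun w => w 0 i0 ^+ (k + p) * 1] = m_ (k + p)); first by ring.
by apply: eq_sphere_int => w _; rewrite mulr1.
Qed.

End sphere_moments.

(** * The order parameter and the equilibria *)

Section order_parameter.
Context {R : realType} {n : nat} (hn : (2 <= n)%N).
Local Notation c := (@order_param R n).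

Lemma order_paramE (kappa : R) : c kappa = moment (n - 2) 1 kappa / moment (n - 2) 0 kappa.
Proof.
by rewrite /order_param /moment; congr (_ / _); apply: eq_Rintegral => t _; rewrite ?mul1r.
Qed.

(** The quotient c(kappa)/kappa, extended to kappa = 0. Integration by parts turns it into a ratio
    of positive continuous integrals, so that its sign and its limit at 0 are visible. *)
Definition order_slope (kappa : R) : R :=
  moment n 0 kappa / ((n - 1)%:R * moment (n - 2) 0 kappa).

Lemma order_param_slope kappa : c kappa = kappa * order_slope kappa.
Proof.
have n1 : (n - 2).+1 = (n - 1)%N by rewrite -subSn.
have n2 : (n - 2).+2 = n by rewrite -addn2 subnK.
have := moment_recl (n - 2) 0 kappa; rewrite mul0r add0r -moment_sin n2 n1 => H.
have n10 : (n - 1)%:R != 0 :> R by rewrite pnatr_eq0 subn_eq0 -ltnNge.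
have I0 := lt0r_neq0 (moment0_gt0 (n - 2) kappa).
rewrite order_paramE /order_slope; apply: (mulfI n10).
rewrite [LHS]mulrA H; field.
by rewrite I0 n10.
Qed.

Lemma order_slope_gt0 kappa : 0 < order_slope kappa.
Proof.
by rewrite divr_gt0 ?mulr_gt0 ?moment0_gt0// ltr0n subn_gt0.
Qed.

Lemma order_slope_continuous : continuous order_slope.
Proof.
apply: continuous_funM; first exact: moment_continuous.
move=> x; apply: (@cvgV _ _ _ _ (fun x => (n - 1)%:R * moment (n - 2) 0 x)).
  by rewrite mulf_neq0 ?lt0r_neq0 ?moment0_gt0// ltr0n subn_gt0.
by apply: continuous_funZ; exact: moment_continuous.
Qed.

Lemma order_slope0 : order_slope 0 = n%:R^-1.
Proof.
have n2 : (n - 2).+2 = n by rewrite -addn2 subnK.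
have := moment0_1 (R := R) (n - 2); have := moment_sin (n - 2) 0 (0 : R); rewrite n2.
have I0 := lt0r_neq0 (moment00_gt0 (R := R) (n - 2)).
rewrite /order_slope => -> H.
have n0 : n%:R != 0 :> R by rewrite pnatr_eq0 -lt0n ltnW.
have n1 : (n - 1)%:R != 0 :> R by rewrite pnatr_eq0 subn_eq0 -ltnNge.
move: n1; rewrite (natrB _ (ltnW hn)) => n1.
rewrite -H; have := I0; rewrite -H mulf_eq0 negb_or => /andP[_ I2].
by field; rewrite I2 n0 n1.
Qed.

Lemma order_param0 : c 0 = 0. Proof. by rewrite order_param_slope mul0r. Qed.

Lemma order_param_gt0 kappa : 0 < kappa -> 0 < c kappa.
Proof. by move=> k0; rewrite order_param_slope mulr_gt0// order_slope_gt0. Qed.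

Lemma order_param_ge0 kappa : 0 <= kappa -> 0 <= c kappa.
Proof. by move=> k0; rewrite order_param_slope mulr_ge0// ltW// order_slope_gt0. Qed.

Lemma order_param_le1 kappa : c kappa <= 1.
Proof.
rewrite order_paramE ler_pdivrMr ?moment0_gt0// mul1r; apply: le_Rintegral => //.
- exact: moment_integrable.
- exact: moment_integrable.
move=> t /=; rewrite in_itv /= => tpi.
rewrite expr1 expr0 mul1r -mulrA ler_piMl ?cos_le1//.
by rewrite mulr_ge0 ?expR_ge0// exprn_ge0// sin_ge0_pi.
Qed.

Lemma order_param_continuous : continuous c.
Proof.
rewrite (_ : c = fun x => x * order_slope x); last by apply/funext => x; exact: order_param_slope.
by apply: continuous_funM; [move=> x; exact: cvg_id|exact: order_slope_continuous].
Qed.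

End order_parameter.

(** * Von Mises distributions and the classification of equilibria *)

Section von_mises.
Context {R : realType} {n : nat} (hn : (2 <= n)%N).
Context (mu : probability (borelRV R n) R) (hmu : uniform_on_sphere mu).
Local Notation S := (@usphere R n).
Local Notation "'E[' f ]" := (\int[mu]_(w in S) f w).
Local Notation c := (@order_param R n).
Implicit Types (f : 'rV[R]_n -> R) (x y v w Om : 'rV[R]_n) (kappa rho : R).

Let Z kappa Om := E[fun w => expR (kappa * dotp w Om)].

Lemma cont_off0_vonMises kappa Om : cont_off0 (fun w => expR (kappa * dotp w Om)).
Proof.
apply: (cont_off0_comp (h := expR)); first exact: continuous_expR.
by apply: cont_off0M; [exact: cont_off0_cst|exact: cont_off0_dotp].
Qed.

Lemma usphere_nonempty : exists Om, S Om.
Proof.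
exists (delta_mx 0 (Ordinal (ltnW hn))); apply/usphereE.
rewrite /dotp (bigD1 (Ordinal (ltnW hn)))//= mxE !eqxx mulr1 big1 ?addr0// => k ki.
by rewrite mxE eqxx /= (negbTE ki) mulr0.
Qed.

Lemma moment_partition kappa Om : S Om ->
  moment (n - 2) 0 kappa = moment (n - 2) 0 0 * Z kappa Om.
Proof.
move=> SOm; rewrite (sphere_exp_moment hn hmu 0 kappa SOm); congr (_ * _).
by apply: eq_sphere_int => w _; rewrite mul1r.
Qed.

Lemma partition_gt0 kappa Om : S Om -> 0 < Z kappa Om.
Proof.
move=> SOm; have := moment0_gt0 (n - 2) kappa; rewrite (moment_partition kappa SOm).
by rewrite pmulr_rgt0// moment00_gt0.
Qed.

Lemma sphere_order_param kappa Om : S Om ->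
  E[fun w => dotp w Om * expR (kappa * dotp w Om)] = c kappa * Z kappa Om.
Proof.
move=> SOm; have Z0 := lt0r_neq0 (partition_gt0 kappa SOm).
have I0 := lt0r_neq0 (moment00_gt0 (R := R) (n - 2)).
rewrite order_paramE (sphere_exp_moment hn hmu 1 kappa SOm) (moment_partition kappa SOm).
by rewrite invfM mulrACA mulfV// mul1r mulrVK ?unitfE.
Qed.

(** The reflection in v preserves w.Om and changes the sign of w.v, so the integral equals its
    opposite. *)
Lemma sphere_odd_eq0 kappa Om v : dotp v Om = 0 ->
  E[fun w => dotp w v * expR (kappa * dotp w Om)] = 0.
Proof.
move=> vOm; have [->|v0] := eqVneq v 0.
  rewrite -[RHS](sphere_int_cst hmu 0); apply: eq_sphere_int => w _.
  by rewrite dotpC /dotp big1 ?mul0r// => i _; rewrite mxE mul0r.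
have vv : dotp v v != 0 by rewrite dotpxx_eq0.
have cf : cont_off0 (fun w => dotp w v * expR (kappa * dotp w Om)).
  by apply: cont_off0M; [exact: cont_off0_dotp|exact: cont_off0_vonMises].
have H := sphere_int_orthogonal hmu (householder_orthogonal v0) cf.
suff E0 : E[fun w => dotp w v * expR (kappa * dotp w Om)] =
    - E[fun w => dotp w v * expR (kappa * dotp w Om)].
  by move: E0; move: (Rintegral _ _ _) => a; lra.
rewrite -[in LHS]H -mulN1r -sphere_intZ; last exact: cf.
apply: eq_sphere_int => w _.
rewrite mulmx_householder !dotpBl !dotpZl vOm mulr0 subr0 mulrA; congr (_ * _).
by field.
Qed.

Lemma profile_mass f Om (C kappa : R) : S Om ->
  (forall w, S w -> f w = C * expR (kappa * dotp w Om)) -> mass mu f = C * Z kappa Om.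
Proof.
move=> SOm fE; rewrite /mass (eq_sphere_int mu fE) sphere_intZ//.
exact: cont_off0_vonMises.
Qed.

Lemma profile_flux f Om (C kappa : R) : S Om ->
  (forall w, S w -> f w = C * expR (kappa * dotp w Om)) ->
  flux mu f = (C * Z kappa Om * c kappa) *: Om.
Proof.
move=> SOm fE; apply/rowP => i; rewrite !mxE.
pose e : 'rV[R]_n := delta_mx 0 i.
have dote w : dotp w e = w 0 i.
  rewrite /dotp (bigD1 i)//= mxE !eqxx mulr1 big1 ?addr0// => k ki.
  by rewrite mxE eqxx /= (negbTE ki) mulr0.
(* The i-th basis vector is split into its component along Om, which gives the order parameter, and
   a part orthogonal to Om, which integrates to zero. *)
pose v := e - Om 0 i *: Om.
have vOm : dotp v Om = 0.
  by rewrite dotpBl dotpZl dotp_usphere// mulr1 dotpC dote subrr.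
have dotv w : dotp w v = w 0 i - Om 0 i * dotp w Om.
  by rewrite dotpC dotpBl dotpZl dotpC dote [dotp Om w]dotpC.
have cE : cont_off0 (fun w => expR (kappa * dotp w Om)) by exact: cont_off0_vonMises.
transitivity (C * (E[fun w => dotp w v * expR (kappa * dotp w Om)] +
    Om 0 i * E[fun w => dotp w Om * expR (kappa * dotp w Om)])).
  have cOm : cont_off0 (fun w => dotp w Om * expR (kappa * dotp w Om)).
    by apply: cont_off0M => //; exact: cont_off0_dotp.
  have cv : cont_off0 (fun w => dotp w v * expR (kappa * dotp w Om)).
    by apply: cont_off0M => //; exact: cont_off0_dotp.
  rewrite -sphere_intZ// -sphere_intD//; last by apply: cont_off0M => //; exact: cont_off0_cst.
  rewrite -sphere_intZ//; last by apply: cont_off0D => //; apply: cont_off0M => //; exact: cont_off0_cst.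
  by apply: eq_sphere_int => w Sw; rewrite fE// dotv; ring.
rewrite sphere_odd_eq0// add0r sphere_order_param//; ring.
Qed.

Lemma vonMises_profile rho kappa Om w :
  rho * vonMises mu kappa Om w = rho / Z kappa Om * expR (kappa * dotp w Om).
Proof. by rewrite /vonMises -/(Z kappa Om) mulrCA mulrC. Qed.

(** Multiplying the identities at Om and at -Om cancels the exponentials and gives equal
    normalisations, so the exponents agree. With t = Om.Om', the points Om and Om' then give kappa =
    kappa' t and kappa t = kappa', hence kappa^2 = kappa'^2. *)
Lemma vonMises_inj rho kappa kappa' Om Om' : 0 < rho -> 0 <= kappa -> 0 <= kappa' ->
  S Om -> S Om' ->
  (forall w, S w -> rho * vonMises mu kappa Om w = rho * vonMises mu kappa' Om' w) ->
  kappa = kappa'.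
Proof.
move=> rho0 k0 k0' SOm SOm' H.
have Z0 := partition_gt0 kappa SOm; have Z0' := partition_gt0 kappa' SOm'.
have SN w : S w -> S (- w).
  by move=> /usphereE w1; apply/usphereE; rewrite -scaleN1r dotpZl dotpC dotpZl w1; ring.
have dotN w v : dotp (- w) v = - dotp w v by rewrite -scaleN1r dotpZl mulN1r.
move: Z0 Z0' H; rewrite /vonMises -/(Z kappa Om) -/(Z kappa' Om').
move: (Z kappa Om) (Z kappa' Om') => z z' z0 z0' H.
have {}H w : S w -> expR (kappa * dotp w Om) * z' = expR (kappa' * dotp w Om') * z.
  move=> /H /(mulfI (lt0r_neq0 rho0)) /eqP.
  by rewrite eqr_div ?lt0r_neq0// => /eqP.
have zz : z = z'.
  have H1 := H Om SOm; have H2 := H (- Om) (SN _ SOm).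
  have : z' ^+ 2 == z ^+ 2.
    move: H2; rewrite !dotN !mulrN => H2; apply/eqP.
    have := congr2 *%R H1 H2; rewrite mulrACA [RHS]mulrACA -!expRD !subrr expR0 !mul1r.
    by rewrite -!expr2.
  by rewrite eqrXn2 ?(ltW z0) ?(ltW z0')// => /eqP.
have {}H w : S w -> kappa * dotp w Om = kappa' * dotp w Om'.
  by move=> /H; rewrite zz => /(mulIf (lt0r_neq0 z0')) /expR_inj.
have := H Om SOm; have := H Om' SOm'.
rewrite dotp_usphere// dotp_usphere// (dotpC Om' Om) !mulr1; move: (dotp _ _) => t H1 H2.
apply/eqP; rewrite -(eqrXn2 (n := 2))//; apply/eqP.
by rewrite !expr2 {2}H2 -{2}H1; ring.
Qed.

Lemma vonMises_not_isotropic rho kappa Om f : 0 < rho -> 0 < kappa -> S Om ->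
  (forall w, S w -> f w = rho * vonMises mu kappa Om w) -> ~ isotropic f.
Proof.
move=> rho0 k0 SOm fE [a fa].
have SN : S (- Om).
  have /usphereE w1 := SOm; apply/usphereE; rewrite -scaleN1r dotpZl dotpC dotpZl w1; ring.
have Z0 := partition_gt0 kappa SOm.
have := fa _ SOm; rewrite -(fa _ SN) !fE// !vonMises_profile.
have C0 : rho / Z kappa Om != 0 by rewrite mulf_neq0// ?invr_eq0 lt0r_neq0.
move=> /(mulfI C0) /expR_inj.
by rewrite -scaleN1r dotpZl dotp_usphere//; lra.
Qed.

Lemma direction_scale (a : R) Om : 0 < a -> S Om -> direction (a *: Om) = Om.
Proof.
move=> a0 SOm; rewrite /direction enormZ ?ltW// (_ : enorm Om = 1)// mulr1 scalerA.
by rewrite mulVf ?scale1r// lt0r_neq0.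
Qed.

Lemma direction_usphere x : x != 0 -> S (direction x).
Proof. exact: normalize_usphere. Qed.

Section equilibria.
Context (nu tau : R -> R) (tau_gt0 : forall r, 0 <= r -> 0 < tau r)
  (nu_ge0 : forall r, 0 <= r -> 0 <= nu r) (k0 : kfun nu tau 0 = 0).
Local Notation k := (kfun nu tau).

(** Whether or not the flux J vanishes, Q(f) = 0 takes the form Laplacian = kappa times drift with
    kappa = k(|J|): for J = 0 any direction will do, since k(0) = 0. The mass then fixes the
    constant of the profile, and recomputing |J| from the profile closes the equation for kappa. *)
Lemma equilibrium_vonMises f rho : 0 < rho -> equilibrium mu nu tau f -> mass mu f = rho ->
  exists kappa Om, [/\ 0 <= kappa, S Om, kappa = k (rho * c kappa) &
    forall w, S w -> f w = rho * vonMises mu kappa Om w].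
Proof.
move=> rho0 [C2f _ Qf] mf.
have [kappa [Om [kappa0 SOm kJ eqf]]] : exists kappa Om, [/\ 0 <= kappa, S Om,
   kappa = k (enorm (flux mu f)) &
   forall w, S w -> sphere_lap f w = kappa * drift_div f Om w].
  have [J0|J0] := eqVneq (flux mu f) 0.
    have [Om SOm] := usphere_nonempty; exists 0, Om; split=> // [|w Sw].
      by rewrite J0 /enorm (eqP (_ : dotp 0 0 == 0)) ?dotpxx_eq0// sqrtr0 k0.
    have := Qf w Sw; rewrite /Qop J0 eqxx mul0r => /eqP.
    by rewrite mulf_eq0 gt_eqF ?tau_gt0//= => /eqP.
  exists (k (enorm (flux mu f))), (direction (flux mu f)); split=> //.
  - rewrite /kfun divr_ge0//; first exact/nu_ge0/enorm_ge0.
    exact/ltW/tau_gt0/enorm_ge0.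
  - exact: direction_usphere.
  - move=> w Sw; have := Qf w Sw; rewrite /Qop (negbTE J0) mulNr addrC => /eqP.
    rewrite subr_eq0 => /eqP H; rewrite /kfun.
    have t0 := lt0r_neq0 (tau_gt0 (enorm_ge0 (flux mu f))).
    by apply: (mulfI t0); rewrite H mulrA mulrCA mulfV ?mulr1.
have [C fE] := drift_diffusion_stationary hmu hn C2f eqf.
have CZ : C * Z kappa Om = rho by rewrite -mf (profile_mass SOm fE).
exists kappa, Om; split=> //.
  rewrite {1}kJ (profile_flux SOm fE) CZ enormZ; last by rewrite mulr_ge0 ?(order_param_ge0 hn)// ltW.
  by rewrite (_ : enorm Om = 1)// mulr1.
move=> w Sw; rewrite fE// vonMises_profile -CZ mulfK//.
by rewrite lt0r_neq0// partition_gt0.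
Qed.

Lemma vonMises_equilibrium f rho kappa Om : 0 < rho -> 0 <= kappa -> S Om ->
  kappa = k (rho * c kappa) ->
  (forall w, S w -> f w = rho * vonMises mu kappa Om w) ->
  equilibrium mu nu tau f /\ mass mu f = rho.
Proof.
move=> rho0 kappa0 SOm kE fE; have Z0 := partition_gt0 kappa SOm.
have {}fE w : S w -> f w = rho / Z kappa Om * expR (kappa * dotp w Om).
  by move=> Sw; rewrite fE// vonMises_profile.
have [C2f eqf] := vonMises_solves fE.
split; last by rewrite (profile_mass SOm fE) divfK// lt0r_neq0.
split=> // [w Sw|w Sw].
  by rewrite fE// mulr_ge0 ?expR_ge0// divr_ge0// ltW.
have JE : flux mu f = (rho * c kappa) *: Om.
  by rewrite (profile_flux SOm fE) divfK// lt0r_neq0.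
(* At kappa = 0 the flux is zero and [Qop] takes its other branch; for kappa > 0 the flux is a
   positive multiple of Om, so its direction is Om. *)
rewrite /Qop JE; have [kap0|kapN0] := eqVneq kappa 0.
  by rewrite kap0 order_param0// mulr0 scale0r eqxx eqf// kap0 mul0r mulr0.
have kap_gt0 : 0 < kappa by rewrite lt_def kapN0.
have a0 : 0 < rho * c kappa by rewrite mulr_gt0// order_param_gt0.
have -> : ((rho * c kappa) *: Om == 0) = false.
  by apply/negbTE; rewrite scaler_eq0 negb_or gt_eqF//= usphere_neq0.
rewrite direction_scale// enormZ ?ltW// (_ : enorm Om = 1)// mulr1 eqf//.
rewrite -/(drift_div f Om w) [X in _ + _ * (X * _)]kE /kfun.
have t0 := lt0r_neq0 (tau_gt0 (ltW a0)).
by field.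
Qed.
End equilibria.
End von_mises.

(** * The compatibility equation *)

Section coefficients.
Context {R : realType}.
Implicit Types (r s kappa rho : R).

Lemma lipschitz_pair (f : R -> R) (A : set R) : [lipschitz f x | x in A] ->
  exists2 K, 0 < K & forall x y, A x -> A y -> `|f x - f y| <= K * `|x - y|.
Proof.
move=> /pinfty_ex_gt0[K K0 H]; exists K => // x y Ax Ay.
exact: (H (x, y) (conj Ax Ay)).
Qed.

Lemma lipschitz_pair_continuous (f : R -> R) (A : set R) (x : R) K : 0 < K ->
  (forall x y, A x -> A y -> `|f x - f y| <= K * `|x - y|) ->
  (\forall y \near x, A y) -> {for x, continuous f}.
Proof.
move=> K0 lipf Ax; apply/cvgrPdist_le => e e0; near=> y.
apply: (@le_trans _ _ (K * `|x - y|)).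
  by apply: lipf; [exact: nbhs_singleton Ax|near: y].
rewrite -ler_pdivlMl//; near: y; apply/nbhs_ballP; exists (K^-1 * e) => /=.
  by rewrite mulr_gt0// invr_gt0.
by move=> y /ltW.
Unshelve. all: by end_near. Qed.

(** The Cauchy criterion at 0; it applies to nu(r)/r, whose value at r = 0 carries no
    information. *)
Lemma lipschitz_pair_at_right (f : R -> R) K : 0 < K ->
  (forall x y, 0 < x -> 0 < y -> `|f x - f y| <= K * `|x - y|) ->
  cvg (f x @[x --> 0^'+]).
Proof.
move=> K0 lipf; apply/cauchy_cvgP; apply: cauchy_exP => e e0.
(* On the interval from 0 to d all values lie within K d = e/2 of f(d). *)
pose d := e / (K * 2); have d0 : 0 < d by rewrite divr_gt0// mulr_gt0.
exists (f d); suff : \forall x \near 0^'+, ball (f d) e (f x) by [].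
near=> x; rewrite -ball_normE /=.
have x0 : 0 < x by near: x; exact: nbhs_right_gt.
have xd : x < d by near: x; exact: nbhs_right_lt.
apply: (@le_lt_trans _ _ (K * d)).
  apply: (le_trans (lipf _ _ d0 x0)); rewrite ler_wpM2l// ?ltW//.
  by rewrite gtr0_norm; lra.
have -> : K * d = e / 2 by rewrite /d; field; exact: lt0r_neq0.
by lra.
Unshelve. all: by end_near. Qed.

(** The case D = 0 is the one where the threshold is infinite; positivity of u fixes the sign of the
    infinity. *)
Lemma cvge_inv_at_right (u : R -> R) (a D : R) : 0 < a ->
  (\forall r \near 0^'+, 0 < u r) -> u r @[r --> 0^'+] --> D ->
  (a / u r)%:E @[r --> 0^'+] --> (if D == 0 then +oo%E else (a / D)%:E).
Proof.
move=> a0 u0 uD; case: eqVneq => [D0|D0].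
  apply/cvgeryP/cvgryPge => M; have [M0|M0] := leP M 0.
    near=> r; have ur0 : 0 < u r by near: r.
    by apply: (le_trans M0); rewrite divr_ge0 ?ltW.
  near=> r; have ur0 : 0 < u r by near: r.
  rewrite ler_pdivlMr// mulrC -ler_pdivlMr//; near: r.
  by apply: (cvgr_le _ uD); rewrite D0 divr_gt0.
apply/fine_cvgP; split; first exact: nearW.
by apply: cvgM; [exact: cvg_cst|exact: cvgV].
Unshelve. all: by end_near. Qed.

Context (nu tau j : R -> R) (hcoef : admissible_coeffs nu tau j).
Local Notation k := (kfun nu tau).

Lemma nu_ge0 r : 0 <= r -> 0 <= nu r.
Proof. by case: hcoef => -[+ _ _ _] _; exact. Qed.

Lemma tau_gt0 r : 0 <= r -> 0 < tau r.
Proof. by case: hcoef => -[_ + _ _] _; exact. Qed.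

Lemma kfun_lt r s : 0 <= r -> r < s -> k r < k s.
Proof. by case: hcoef => _ [+ _ _]; exact. Qed.

Lemma j_dom kappa : kappa_dom nu tau kappa -> 0 <= j kappa /\ k (j kappa) = kappa.
Proof. by case: hcoef => _ [_ + _]; exact. Qed.

Lemma jK r : 0 <= r -> j (k r) = r.
Proof. by case: hcoef => _ [_ _ +]; exact. Qed.

Lemma kfun_le r s : 0 <= r -> r <= s -> k r <= k s.
Proof. by move=> r0; rewrite le_eqVlt => /predU1P[->//|rs]; apply/ltW/kfun_lt. Qed.

Lemma kfun_ge0 r : 0 <= r -> 0 <= k r.
Proof. by move=> r0; rewrite divr_ge0 ?nu_ge0// ltW// tau_gt0. Qed.

Lemma kappa_dom_k r : 0 <= r -> kappa_dom nu tau (k r).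
Proof.
move=> r0; split; first exact: kfun_ge0.
(* Freezing k at k(0) on the negative axis makes it monotone on the whole line, so its limit at
   infinity is the supremum of its range. *)
pose f s := (k (Num.max s 0))%:E.
have ndf : nondecreasing_fun f.
  move=> x y xy; rewrite lee_fin; apply: kfun_le; first by rewrite le_max lexx orbT.
  by rewrite ge_max !le_max xy lexx orbT.
have -> : kappa_max nu tau = ereal_sup (range f).
  apply/cvg_lim => //; apply: cvg_trans (nondecreasing_cvge ndf).
  apply: near_eq_cvg; near=> s.
  have s0 : 0 <= s by near: s; exact: nbhs_pinfty_ge.
  by rewrite /f max_l.
(* One further unit in r gives the strict inequality with the supremum. *)
apply: (@lt_le_trans _ _ (k (r + 1))%:E).
  by rewrite lte_fin; apply: kfun_lt => //; rewrite ltrDl.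
apply: ereal_sup_ubound; exists (r + 1) => //.
by rewrite /f max_l// addr_ge0.
Unshelve. all: by end_near. Qed.

(** Since k(j 0) = 0 and k is nonnegative and strictly increasing, j 0 cannot be positive. That k(0)
    = 0 is only deduced from this. *)
Lemma j_at0 : j 0 = 0.
Proof.
have kd0 : kappa_dom nu tau 0.
  split=> //; have [_] := kappa_dom_k (lexx 0).
  by apply: le_lt_trans; rewrite lee_fin kfun_ge0.
have [j_at0 kj0] := j_dom kd0; apply/eqP; rewrite eq_le j_at0 andbT leNgt; apply/negP => j0p.
by have := kfun_lt (lexx 0) j0p; rewrite kj0 ltNge kfun_ge0.
Qed.

Lemma kappa_dom0 : kappa_dom nu tau 0.
Proof.
split=> //; have [_] := kappa_dom_k (lexx 0).
by apply: le_lt_trans; rewrite lee_fin kfun_ge0.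
Qed.

Lemma kfun0 : k 0 = 0.
Proof. by have [_] := j_dom kappa_dom0; rewrite j_at0. Qed.

Lemma kfun_gt0 r : 0 < r -> 0 < k r.
Proof. by move=> r0; rewrite -kfun0; exact: kfun_lt. Qed.

Lemma j_gt0 kappa : kappa_dom nu tau kappa -> 0 < kappa -> 0 < j kappa.
Proof.
move=> kd kp; have [j0' kj] := j_dom kd; rewrite lt_def j0' andbT.
by apply: contraTneq kp => jk; rewrite -kj jk kfun0 ltxx.
Qed.

Lemma kappa_dom_lt kappa r : 0 <= r -> 0 <= kappa -> kappa <= k r -> kappa_dom nu tau kappa.
Proof.
move=> r0 kp kr; split=> //; apply: le_lt_trans (kappa_dom_k r0).2.
by rewrite lee_fin.
Qed.

Lemma j_lt kappa r : 0 < r -> 0 < kappa -> kappa < k r -> 0 < j kappa < r.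
Proof.
move=> r0 kp kr; have kd := kappa_dom_lt (ltW r0) (ltW kp) (ltW kr).
rewrite j_gt0//= ltNge; apply/negP => rj.
by have := kfun_le (ltW r0) rj; rewrite (j_dom kd).2 leNgt kr.
Qed.

(** Monotonicity of k alone suffices: 0 < kappa < k(d/2) forces 0 < j(kappa) < d/2. Convergence from
    the right, with positivity, is what composing with limits in r requires. *)
Lemma j_cvg_at_right : j kappa @[kappa --> 0^'+] --> 0^'+.
Proof.
move=> A /nbhs_ballP[d /= d0 dA]; suff : \forall kappa \near 0^'+, A (j kappa) by [].
have d20 : 0 < d / 2 by rewrite divr_gt0.
near=> kappa; have kp : 0 < kappa by near: kappa; exact: nbhs_right_gt.
have kd : kappa < k (d / 2) by near: kappa; apply: nbhs_right_lt; exact: kfun_gt0.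
have /andP[jp jd] := j_lt d20 kp kd.
by apply: dA => //; rewrite -ball_normE /= sub0r normrN gtr0_norm//; lra.
Unshelve. all: by end_near. Qed.

Lemma kfun_continuous r : 0 < r -> {for r, continuous k}.
Proof.
move=> r0; case: hcoef => -[_ _ [lnu _] [ltau _]] _.
have [K K0 lipg] := lipschitz_pair lnu; have [K' K'0 lipt] := lipschitz_pair ltau.
have cg : {for r, continuous (fun r => nu r / r)}.
  by apply: (lipschitz_pair_continuous K0 lipg); exact: lt_nbhsr.
have ct : {for r, continuous tau}.
  by apply: (lipschitz_pair_continuous K'0 lipt); near=> s; apply: ltW; near: s; exact: lt_nbhsr.
apply: (@near_eq_continuous _ _ (fun s => nu s / s * s / tau s)).
  near=> s; rewrite /kfun divfK// lt0r_neq0//; near: s; exact: lt_nbhsr.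
apply: continuousM; first by apply: continuousM => //; exact: cvg_id.
by apply: continuousV => //; rewrite lt0r_neq0// tau_gt0// ltW.
Unshelve. all: by end_near. Qed.

Lemma kfun_slope_cvg : exists2 D : R, 0 <= D & k r / r @[r --> 0^'+] --> D.
Proof.
case: hcoef => -[_ _ [lnu _] [ltau _]] _.
have [K K0 lipg] := lipschitz_pair lnu; have [K' K'0 lipt] := lipschitz_pair ltau.
have /cvg_ex[G gG] := lipschitz_pair_at_right K0 lipg.
have tau0 : tau r @[r --> 0^'+] --> tau 0.
  apply/cvgrPdist_le => e e0; near=> r.
  have r0 : 0 < r by near: r; exact: nbhs_right_gt.
  apply: le_trans (lipt _ _ (lexx 0) (ltW r0)) _.
  rewrite sub0r normrN gtr0_norm// -ler_pdivlMl// ltW//; near: r.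
  by apply: nbhs_right_lt; rewrite mulr_gt0// invr_gt0.
have kG : k r / r @[r --> 0^'+] --> G / tau 0.
  apply: cvg_trans (_ : (nu r / r) / tau r @[r --> 0^'+] --> G / tau 0).
    apply: near_eq_cvg; near=> r; rewrite /kfun; ring.
  by apply: cvgM => //; apply: cvgV => //; rewrite lt0r_neq0// tau_gt0.
exists (G / tau 0) => //; apply: (cvgr_to_ge kG); near=> r.
have r0 : 0 < r by near: r; exact: nbhs_right_gt.
by rewrite divr_ge0 ?kfun_ge0 ?ltW.
Unshelve. all: by end_near. Qed.

Lemma kfun_cvg0 : k r @[r --> 0^'+] --> 0.
Proof.
have [D _ kD] := kfun_slope_cvg.
have : k r / r * r @[r --> 0^'+] --> D * 0.
  by apply: cvgM => //; apply: cvg_at_right_filter; exact: cvg_id.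
rewrite mulr0; apply: cvg_trans; apply: near_eq_cvg; near=> r.
by rewrite divfK// lt0r_neq0//; near: r; exact: nbhs_right_gt.
Unshelve. all: by end_near. Qed.

Context {n : nat} (hn : (2 <= n)%N).
Local Notation c := (@order_param R n).
Local Notation Phi := (fun r => r / c (k r)).

(** If D is the limit of k(r)/r, all three limits are n/D, read as infinity for D = 0, because
    c(kappa)/kappa tends to 1/n. The limit in kappa is the limit in r composed with j. *)
Lemma rho_c_cvg : exists l : \bar R, [/\
  (j kappa / c kappa)%:E @[kappa --> 0^'+] --> l,
  (r / c (k r))%:E @[r --> 0^'+] --> l,
  (n%:R * r / k r)%:E @[r --> 0^'+] --> l & (0 < l)%E].
Proof.
have [D D0 kD] := kfun_slope_cvg; have n0 : 0 < n%:R :> R by rewrite ltr0n ltnW.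
pose l : \bar R := if D == 0 then +oo%E else (n%:R / D)%:E.
have near0 : \forall r \near 0^'+, 0 < r :> R by exact: nbhs_right_gt.
have H3 : (n%:R * r / k r)%:E @[r --> 0^'+] --> l.
  apply: cvg_trans (cvge_inv_at_right n0 _ kD).
    apply: near_eq_cvg; near=> r; congr (_%:E); rewrite invf_div mulrA//.
  by near=> r; rewrite divr_gt0 ?kfun_gt0//; near: r.
have H2 : (r / c (k r))%:E @[r --> 0^'+] --> l.
  have -> : l = if D / n%:R == 0 then +oo%E else (1 / (D / n%:R))%:E.
    rewrite mulf_eq0 invr_eq0 (gt_eqF n0) orbF /l; case: ifP => // _.
    by rewrite invf_div mul1r.
  have qk : k r / r * order_slope (n := n) (k r) @[r --> 0^'+] --> D / n%:R.
    apply: cvgM => //; rewrite -(order_slope0 hn).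
    by apply: (cvg_comp _ _ kfun_cvg0); exact: (order_slope_continuous hn).
  apply: cvg_trans (cvge_inv_at_right ltr01 _ qk).
    apply: near_eq_cvg; near=> r; congr (_%:E).
    have r0 : 0 < r by near: r.
    have kr0 := kfun_gt0 r0; have q0 := order_slope_gt0 hn (k r).
    by rewrite order_param_slope//; field; rewrite !lt0r_neq0.
  near=> r; have r0 : 0 < r by near: r.
  by apply: mulr_gt0; [apply: divr_gt0 => //; exact: kfun_gt0|exact: order_slope_gt0].
have l0 : (0 < l)%E.
  rewrite /l; case: eqVneq => [_|DN0]; first by rewrite ltry.
  by rewrite lte_fin divr_gt0// lt_def DN0.
exists l; split; [|exact: H2|exact: H3|exact: l0].
apply: cvg_trans (cvg_comp _ _ j_cvg_at_right H2).
apply: near_eq_cvg; near=> kappa => /=.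
have kp : 0 < kappa by near: kappa.
have k1 : kappa <= k 1 by near: kappa; apply: nbhs_right_le; exact: kfun_gt0.
by rewrite (j_dom (kappa_dom_lt ler01 (ltW kp) k1)).2.
Unshelve. all: by end_near. Qed.

Lemma ratio_ge r : 0 < r -> r <= r / c (k r).
Proof.
move=> r0; have c0 := order_param_gt0 hn (kfun_gt0 r0).
by rewrite ler_pdivlMr// ler_piMr ?(ltW r0)// order_param_le1.
Qed.

Lemma ratio_continuous r : 0 < r -> {for r, continuous Phi}.
Proof.
move=> r0; apply: continuousM; first exact: cvg_id.
apply: continuousV; first by rewrite lt0r_neq0// (order_param_gt0 hn)// kfun_gt0.
by apply: continuous_comp; [exact: kfun_continuous|exact: (order_param_continuous hn)].
Qed.

Lemma pos_kappa_domE kappa : (kappa_dom nu tau `&` [set kappa | 0 < kappa]) kappa <->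
  exists2 r, 0 < r & kappa = k r.
Proof.
split=> [[kd kp]|[r r0 ->]].
  by exists (j kappa); [exact: j_gt0|rewrite (j_dom kd).2].
by split; [exact/kappa_dom_k/ltW|exact: kfun_gt0].
Qed.

Lemma pos_solutionsE rho kappa : pos_solutions n nu tau j rho kappa <->
  exists r, [/\ 0 < r, kappa = k r & r / c (k r) = rho].
Proof.
split=> [[[kd jk] kp]|[r [r0 -> <-]]].
  have jp := j_gt0 kd kp; exists (j kappa); split=> //; first by rewrite (j_dom kd).2.
  by rewrite (j_dom kd).2 jk mulfK// lt0r_neq0// (order_param_gt0 hn).
have c0 := order_param_gt0 hn (kfun_gt0 r0).
split; last exact: kfun_gt0.
by split; [exact/kappa_dom_k/ltW|rewrite jK ?ltW// divfK// lt0r_neq0].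
Qed.

Lemma rho_starE : rho_star n nu tau j =
  ereal_inf [set (r / c (k r))%:E | r in [set r : R | 0 < r]].
Proof.
rewrite /rho_star; congr ereal_inf; apply/seteqP; split=> x [].
  by move=> kappa /pos_kappa_domE[r r0 ->] <-; exists r => //; rewrite jK// ltW.
move=> r r0 <-; exists (k r); first by apply/pos_kappa_domE; exists r.
by rewrite jK// ltW.
Qed.

Lemma rho_star_le_rho_c l : (r / c (k r))%:E @[r --> 0^'+] --> l ->
  (rho_star n nu tau j <= l)%E.
Proof.
move=> H; rewrite -(cvg_lim _ H)//; apply: lime_ge; first by apply/cvg_ex; exists l.
have : \forall r \near (0 : R)^'+, 0 < r by exact: nbhs_right_gt.
by apply: filterS => r r0; rewrite rho_starE; apply: ereal_inf_lbound; exists r.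
Qed.

Lemma solutions_below_rho_star rho : (rho%:E < rho_star n nu tau j)%E ->
  solutions n nu tau j rho = [set 0].
Proof.
move=> rhoS; apply/seteqP; split=> kappa /=.
  move=> sk; have [kd _] := sk; have [k0' _] := kd.
  have [->//|kN0] := eqVneq kappa 0; exfalso.
  have /pos_solutionsE[r [r0 _ E]] : pos_solutions n nu tau j rho kappa.
    by split=> //=; rewrite lt_def kN0.
  move: rhoS; rewrite ltNge rho_starE => /negP; apply.
  by apply: ereal_inf_lbound; exists r => //; rewrite E.
by move=> ->; split; [exact: kappa_dom0|rewrite j_at0 (order_param0 hn) mulr0].
Qed.

Lemma pos_solutions_above_rho_star rho : (rho_star n nu tau j < rho%:E)%E ->
  pos_solutions n nu tau j rho !=set0.
Proof.
rewrite rho_starE => /ereal_inf_lt[_ [r /= r0 <-]]; rewrite lte_fin => Hr.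
(* As Phi(s) >= s, a point with Phi(r) < rho lies left of rho, while Phi(rho) >= rho: the
   intermediate value theorem applies between r and rho. *)
have rrho : r < rho by apply: le_lt_trans Hr; exact: ratio_ge.
have rho0 : 0 < rho by exact: lt_trans rrho.
have cP : {within `[r, rho], continuous Phi}.
  apply: continuous_in_subspaceT => s; rewrite inE/= in_itv/= => /andP[rs _].
  by apply: ratio_continuous; exact: lt_le_trans rs.
have [|s sI sE] := IVT (ltW rrho) cP (v := rho).
  by rewrite ge_min le_max (ltW Hr) (ratio_ge rho0) orbT.
exists (k s); apply/pos_solutionsE; exists s; split=> //.
by move: sI; rewrite in_itv/= => /andP[rs _]; exact: lt_le_trans rs.
Qed.
End coefficients.

(** * Parity of level sets *)

Section parity.
Context {R : realType}.
Implicit Types (g : R -> R) (a b v x z : R) (s : seq R).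

Lemma seq_has_max x s : exists2 z, z \in x :: s & forall y, y \in x :: s -> y <= z.
Proof.
elim: s x => [|y s IH] x.
  by exists x; [rewrite mem_head|move=> y; rewrite inE => /eqP ->].
have [z zs zmax] := IH y; have [xz|zx] := leP x z.
  exists z; first by rewrite in_cons zs orbT.
  by move=> t; rewrite in_cons => /predU1P[->//|/zmax].
exists x; first by rewrite mem_head.
by move=> t; rewrite in_cons => /predU1P[->//|/zmax tz]; apply: le_trans tz (ltW zx).
Qed.

Lemma same_side g a b v : a <= b -> (forall x, a <= x <= b -> {for x, continuous g}) ->
  (forall x, a <= x <= b -> g x != v) -> 0 < (g a - v) * (g b - v).
Proof.
move=> ab cg gv; have gav : g a != v by apply: gv; rewrite lexx.
have gbv : g b != v by apply: gv; rewrite lexx andbT.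
have cgab : {within `[a, b], continuous g}.
  by apply: continuous_in_subspaceT => x; rewrite inE/= in_itv/= => /cg.
rewrite ltNge; apply/negP => H.
have [|c] := IVT ab cgab (v := v); last by rewrite in_itv/= => /gv /eqP.
rewrite ge_min le_max.
have [p|p] := ltP (g a) v; have [q|q] := ltP (g b) v; rewrite ?(ltW p) ?(ltW q) ?p ?q ?orbT//.
  by move: H; rewrite leNgt nmulr_rgt0 subr_lt0 ?q.
by move: H; rewrite leNgt pmulr_rgt0 subr_gt0 lt_def ?q ?p ?gav ?gbv.
Qed.

(** D times the difference quotient tends to D^2 > 0, so it is positive at both steps h and -h; the
    opposite denominators then force increments of opposite sign. *)
Lemma transversal_crossing g z : derivable g z 1 -> derive1 g z != 0 ->
  exists2 d, 0 < d & forall h, 0 < h -> h < d ->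
    (g (z - h) - g z) * (g (z + h) - g z) < 0.
Proof.
rewrite derive1E => dg; pose D : R := 'D_1 g z; rewrite -/D => D0.
have cvg_D : h^-1 *: (g (h *: 1 + z) - g z) @[h --> 0^'] --> D by exact: dg.
have : \forall h \near 0^', 0 < D * (h^-1 *: (g (h *: 1 + z) - g z)).
  have cDD : D * (h^-1 *: (g (h *: 1 + z) - g z)) @[h --> 0^'] --> D * D.
    by apply: cvgM => //; exact: cvg_cst.
  have DD0 : 0 < D * D by rewrite lt_def mulf_neq0//= -expr2 sqr_ge0.
  exact: (cvgr_gt _ cDD).
move=> /nbhs_ballP[d /= d0 dP]; exists d => // h h0 hd.
have Hp : 0 < D * (h^-1 * (g (z + h) - g z)).
  have := dP h; rewrite /= -ball_normE /= sub0r normrN gtr0_norm// => /(_ hd).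
  by rewrite lt0r_neq0// => /(_ isT); rewrite [h%:A]mulr1 [h + z]addrC.
have Hn : 0 < D * ((- h)^-1 * (g (z - h) - g z)).
  have := dP (- h); rewrite /= -ball_normE /= sub0r opprK gtr0_norm// => /(_ hd).
  by rewrite oppr_eq0 lt0r_neq0// => /(_ isT); rewrite [(- h)%:A]mulr1 [- h + z]addrC.
have := mulr_gt0 Hp Hn; rewrite invrN.
have -> : D * (h^-1 * (g (z + h) - g z)) * (D * (- h^-1 * (g (z - h) - g z))) =
  (D * h^-1) ^+ 2 * - ((g (z - h) - g z) * (g (z + h) - g z)) by ring.
by rewrite pmulr_rgt0 ?oppr_gt0// exprn_even_gt0//= mulf_neq0// invr_eq0 lt0r_neq0.
Qed.

(** Induction on the number of crossings. The largest one, z, is removed: up to z - h the remaining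
    crossings are counted by induction, the sign changes once between z - h and z + h, and none is
    left between z + h and b. *)
Lemma level_parity g v a b s : a < b ->
  (forall x, a <= x <= b -> {for x, continuous g}) -> uniq s ->
  (forall x, (x \in s) = (a < x < b) && (g x == v)) ->
  (forall x, x \in s -> derivable g x 1 /\ derive1 g x != 0) ->
  g a != v -> g b != v -> (0 < (g a - v) * (g b - v)) = ~~ odd (size s).
Proof.
move: {2}(size s) (erefl (size s)) => m; elim: m b s => [|m IH] b s sm ab cg us sE dg gav gbv.
  rewrite sm /=; apply: same_side (ltW ab) cg _ => x; rewrite !le_eqVlt.
  move=> /andP[/predU1P[<-//|ax] /predU1P[->//|xb]].
  by have := sE x; rewrite (size0nil sm) ax xb /= => <-.
case: s sm us sE dg => // x0 s0 sm us sE dg; set s := x0 :: s0 in sm us sE dg *.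
have [z zs zmax] := seq_has_max x0 s0; rewrite -/s in zs zmax.
have := sE z; rewrite zs => /esym/andP[/andP[az zb] /eqP gz].
pose s' := rem z s.
have s's x : x \in s' = (x != z) && (x \in s) by rewrite /s' mem_rem_uniq// inE.
(* The last crossing before z, or a if there is none. *)
have [a' a's a'max] := seq_has_max a s'.
have aa' : a <= a' by apply: a'max; rewrite mem_head.
have a'z : a' < z.
  move: a's; rewrite in_cons => /predU1P[->//|]; rewrite s's => /andP[a'z /zmax].
  by rewrite lt_neqAle a'z.
have [dz dz0] := dg z zs.
have [d d0 dP] := transversal_crossing dz dz0.
(* Half of the minimum: the step stays within the range of the transversality estimate, to the right
   of [a'] and to the left of b. *)
pose h := Num.min d (Num.min (z - a') (b - z)) / 2.
have M0 : 0 < Num.min d (Num.min (z - a') (b - z)) by rewrite !lt_min d0 !subr_gt0 a'z.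
have h0 : 0 < h by rewrite divr_gt0.
have hM : h < Num.min d (Num.min (z - a') (b - z)) by rewrite /h ltr_pdivrMr// ltr_pMr// ltr1n.
move: hM; rewrite !lt_min => /and3P[hd hza hbz].
have H2 := dP h h0 hd; rewrite gz in H2.
have y1 : a < z - h by lra.
have y2 : z + h < b by lra.
have zh : z - h < z by lra.
have zh' : z < z + h by lra.
have gy1 : g (z - h) != v by apply: contraTneq H2 => ->; rewrite subrr mul0r ltxx.
have H1 : (0 < (g a - v) * (g (z - h) - v)) = ~~ odd (size s').
  apply: IH => //.
  - by rewrite size_rem// sm.
  - by move=> x /andP[ax xz]; apply: cg; rewrite ax (le_trans xz)// ltW// (lt_trans zh).
  - exact: rem_uniq.
  - move=> x; rewrite s's sE; apply/idP/idP.
      move=> /andP[xz /andP[/andP[ax xb] gx]]; rewrite ax gx andbT /=.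
      apply: (@le_lt_trans _ _ a'); last by lra.
      by apply: a'max; rewrite in_cons s's xz sE ax xb gx orbT.
    move=> /andP[/andP[ax xz] ->]; rewrite ax (lt_eqF (lt_trans xz zh)) andbT /=.
    by rewrite (lt_trans xz)// (lt_trans zh).
  - by move=> x; rewrite s's => /andP[_ /dg].
have H3 : 0 < (g (z + h) - v) * (g b - v).
  apply: same_side (ltW y2) _ _ => x /andP[zx xb].
    by apply: cg; rewrite xb andbT; lra.
  move: xb; rewrite le_eqVlt => /predU1P[->//|xb]; apply/negP => gx.
  have : x \in s by rewrite sE gx xb andbT; lra.
  by move=> /zmax; lra.
rewrite sm /= negbK -[odd m]negbK; have -> : m = size s' by rewrite size_rem// sm.
rewrite -H1; move: H2 H3 gav gy1; rewrite -[g a == v]subr_eq0 -[g (z - h) == v]subr_eq0.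
move: (g a - v) (g (z - h) - v) (g (z + h) - v) (g b - v) => p q r t.
move=> H2 H3 p0; rewrite neq_lt => /orP[q0|q0].
  have r0 : 0 < r by move: H2; rewrite nmulr_rlt0.
  have t0 : 0 < t by move: H3; rewrite pmulr_rgt0.
  by rewrite pmulr_lgt0// nmulr_lgt0// -leNgt le_eqVlt eq_sym (negbTE p0).
have r0 : r < 0 by move: H2; rewrite pmulr_rlt0.
have t0 : t < 0 by move: H3; rewrite nmulr_rgt0.
by rewrite nmulr_lgt0// pmulr_lgt0// -leNgt le_eqVlt (negbTE p0).
Qed.
End parity.

(** * Parity and number of the families of equilibria *)

Section solution_parity.
Context {R : realType} {n : nat} (hn : (2 <= n)%N).
Context (nu tau j : R -> R) (hcoef : admissible_coeffs nu tau j).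
Local Notation k := (kfun nu tau).
Local Notation F := (fun x => j x / @order_param R n x).

(** The flag [below] records the side of rho on which j/c starts near 0. At the other end the
    quotient exceeds rho, so the number of crossings is even exactly when it also starts above
    rho. *)
Lemma pos_solutions_parity (rho : R) m (below : bool) :
  (\forall kappa \near 0^'+, F kappa != rho /\ (rho < F kappa) = below) ->
  (forall kappa, 0 < kappa -> kappa_dom nu tau kappa -> derivable F kappa 1) ->
  (forall kappa, pos_solutions n nu tau j rho kappa -> derive1 F kappa != 0) ->
  pos_solutions n nu tau j rho #= `I_m -> odd m = ~~ below.
Proof.
move=> /nbhs_ballP[d /= d0 dP] dF F'0 cardm.
(* A value of r that is positive and exceeds rho: there the quotient is at least [rb] > rho, and
   every solution k(r) has r <= rho, so it lies below b. *)
pose rb := Num.max rho 0 + 1; pose b := k rb.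
have rb0 : 0 < rb by rewrite /rb ltr_wpDl// le_max lexx orbT.
have rhorb : rho < rb by rewrite /rb (le_lt_trans (_ : _ <= Num.max rho 0)) ?le_max ?lexx// ltrDl.
have b0 : 0 < b by exact: (kfun_gt0 hcoef).
have Fk r : 0 < r -> F (k r) = r / order_param n (k r) by move=> r0; rewrite (jK hcoef) ?ltW.
have Fb : rho < F b.
  by rewrite Fk//; apply: lt_le_trans rhorb _; exact: (ratio_ge hcoef hn).
pose a := Num.min d b / 2.
have M0 : 0 < Num.min d b by rewrite lt_min d0.
have a0 : 0 < a by rewrite divr_gt0.
have : a < Num.min d b by rewrite /a ltr_pdivrMr// ltr_pMr// ltr1n.
rewrite lt_min => /andP[ad ab].
have small x : 0 < x -> x <= a -> F x != rho /\ (rho < F x) = below.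
  move=> x0 xa; apply: dP => //=; rewrite -ball_normE /= sub0r normrN gtr0_norm//.
  exact: le_lt_trans ad.
have domP x : 0 < x -> x <= b -> kappa_dom nu tau x.
  by move=> x0 xb; apply: (kappa_dom_lt hcoef (ltW rb0) (ltW x0) xb).
(* All positive solutions lie strictly between a and b: up to a the behaviour near 0 excludes them,
   and from b on the bound Phi(r) >= r does. *)
have solE x : pos_solutions n nu tau j rho x <-> (a < x < b) && (F x == rho).
  split=> [/(pos_solutionsE hcoef hn)[r [r0 -> E]]|/andP[/andP[ax xb] /eqP Fx]].
    have kr0 := kfun_gt0 hcoef r0.
    rewrite -Fk// in E; rewrite E eqxx andbT; apply/andP; split.
      by rewrite ltNge; apply/negP => /(small _ kr0)[]; rewrite E eqxx.
    apply: (kfun_lt hcoef (ltW r0)); apply: le_lt_trans rhorb.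
    by rewrite -E (Fk _ r0); exact: (ratio_ge hcoef hn r0).
  have x0 : 0 < x by exact: lt_trans ax.
  split=> //; split; first by apply: domP => //; exact: ltW.
  by rewrite -Fx divfK// lt0r_neq0// (order_param_gt0 hn).
have [f [ff finj fsurj]] : exists f : nat -> R, set_bij `I_m (pos_solutions n nu tau j rho) f.
  by apply/card_set_bijP; rewrite card_eq_sym.
pose s := [seq f i | i <- iota 0 m].
have sE x : x \in s <-> pos_solutions n nu tau j rho x.
  split=> [/mapP[i]|sx].
    by rewrite mem_iota add0n => /andP[_ im] ->; exact: ff.
  have [i im <-] := fsurj _ sx; apply/mapP; exists i => //.
  by rewrite mem_iota add0n.
have us : uniq s.
  rewrite map_inj_in_uniq ?iota_uniq// => i1 i2; rewrite !mem_iota !add0n => /andP[_ h1] /andP[_ h2].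
  by apply: finj; rewrite inE.
have [Fa_neq Fa] := small a a0 (lexx a).
have := @level_parity R F rho a b s ab _ us _ _ Fa_neq _.
rewrite size_map size_iota => H; apply/esym; rewrite -[odd m]negbK -H ?gt_eqF//; last 3 first.
- move=> x /andP[ax xb]; apply/differentiable_continuous/derivable1_diffP.
  have x0 : 0 < x by exact: lt_le_trans ax.
  by apply: dF => //; exact: domP.
- by move=> x; apply/idP/idP => [/sE/solE|/solE/sE].
- move=> x /sE sx; split; last exact: F'0.
  by have [[xd _] x0] := sx; exact: dF.
by rewrite pmulr_lgt0 ?subr_gt0// Fa.
Qed.

Context (mu : probability (borelRV R n) R) (hmu : uniform_on_sphere mu).

(** The right-hand side is the form that the classification of equilibria produces, free of j. *)
Lemma pos_solutions_fixpoint (rho kappa : R) : 0 < rho -> 0 < kappa ->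
  pos_solutions n nu tau j rho kappa <-> kappa = k (rho * order_param n kappa).
Proof.
move=> rho0 kp; split=> [[[kd jk] _]|kE]; first by rewrite -jk (j_dom hcoef kd).2.
have r0 : 0 <= rho * order_param n kappa.
  by rewrite mulr_ge0 ?ltW// (order_param_gt0 hn).
split=> //; split; first by rewrite kE; exact: (kappa_dom_k hcoef).
by rewrite {1}kE (jK hcoef).
Qed.

Lemma vonMises_family_noniso (rho kappa : R) : 0 < rho ->
  pos_solutions n nu tau j rho kappa ->
  vonMises_family mu rho kappa `<=` noniso_equilibria mu nu tau rho.
Proof.
move=> rho0 sk f [Om [SOm fE]]; have [_ /= kp] := sk.
have kE := (pos_solutions_fixpoint rho0 kp).1 sk.
have [eqf mf] := vonMises_equilibrium hn hmu (tau_gt0 hcoef) rho0 (ltW kp) SOm kE fE.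
by split=> //; exact: (vonMises_not_isotropic hn hmu rho0 kp SOm fE).
Qed.

Lemma vonMises_isotropic (rho : R) (Om : 'rV[R]_n) : usphere Om ->
  forall w, usphere w -> rho * vonMises mu 0 Om w = rho.
Proof.
move=> SOm w Sw; rewrite /vonMises mul0r expR0.
rewrite (_ : Rintegral _ _ _ = 1) ?divr1 ?mulr1// -[RHS](sphere_int_cst hmu).
by apply: eq_sphere_int => v _; rewrite mul0r expR0.
Qed.

(** The map from kappa to its family is a bijection. It is onto because any member of a
    non-isotropic family is an equilibrium, whose classification gives a parameter solving the
    equation; this parameter is kappa by uniqueness, and kappa = 0 would make the member constant.
    Uniqueness also gives injectivity. *)
Lemma noniso_families_card (rho : R) : 0 < rho ->
  pos_solutions n nu tau j rho #= noniso_families mu nu tau rho.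
Proof.
move=> rho0; have [Om SOm] := usphere_nonempty (R := R) hn.
have -> : noniso_families mu nu tau rho =
    vonMises_family mu rho @` pos_solutions n nu tau j rho.
  apply/seteqP; split=> [G [kappa [kp -> GP]]|_ [kappa sk <-]]; last first.
    by exists kappa; split=> //; [have [_ /= /ltW] := sk|exact: vonMises_family_noniso].
  exists kappa => //; pose f w := rho * vonMises mu kappa Om w.
  have [eqf mf isof] : noniso_equilibria mu nu tau rho f by apply: GP; exists Om.
  have [kappa1 [Om1 [kp1 SOm1 kE1 fE1]]] :=
    equilibrium_vonMises hn hmu (tau_gt0 hcoef) (nu_ge0 hcoef) (kfun0 hcoef) rho0 eqf mf.
  have kk1 := vonMises_inj hn hmu rho0 kp kp1 SOm SOm1 fE1.
  rewrite -kk1 in kE1; apply/pos_solutions_fixpoint => //.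
  rewrite lt_def kp andbT; apply/eqP => kap0; apply: isof; exists rho => w Sw.
  by rewrite /f kap0; exact: vonMises_isotropic.
rewrite card_eq_sym; apply: inj_card_eq => kappa kappa' /set_mem[_ /= kp] /set_mem[_ /= kp'] E.
have [Om' [SOm' H]] : vonMises_family mu rho kappa' (fun w => rho * vonMises mu kappa Om w).
  by rewrite -E; exists Om.
exact: (vonMises_inj hn hmu rho0 (ltW kp) (ltW kp') SOm SOm' H).
Qed.
End solution_parity.

Theorem proposition2p3 (R : realType) (n : nat) (hn : (2 <= n)%N)
    (mu : probability (borelRV R n) R) (hmu : uniform_on_sphere mu)
    (nu tau j : R -> R) (hcoef : admissible_coeffs nu tau j) :
  [/\ (j kappa / order_param n kappa)%:E @[kappa --> 0^'+] --> rho_c n j,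
      (r / order_param n (kfun nu tau r))%:E @[r --> 0^'+] --> rho_c n j,
      (n%:R * r / kfun nu tau r)%:E @[r --> 0^'+] --> rho_c n j,
      (0 < rho_c n j)%E &
      rho_star n nu tau j =
        ereal_inf [set (r / order_param n (kfun nu tau r))%:E
                  | r in [set r : R | 0 < r]]] /\
  (rho_star n nu tau j <= rho_c n j)%E /\
  [/\ forall rho : R, 0 < rho -> (rho%:E < rho_star n nu tau j)%E ->
        solutions n nu tau j rho = [set 0] /\
        forall f : 'rV[R]_n -> R,
          equilibrium mu nu tau f /\ mass mu f = rho <->
          forall w, usphere w -> f w = rho,
      forall rho : R, 0 < rho -> (rho_star n nu tau j < rho%:E)%E ->
        pos_solutions n nu tau j rho !=set0 /\
        forall kappa, pos_solutions n nu tau j rho kappa ->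
          vonMises_family mu rho kappa `<=` noniso_equilibria mu nu tau rho &
      forall eps : R,
        (rho_c n j < +oo)%E ->
        (forall kappa, 0 < kappa -> kappa_dom nu tau kappa ->
          derivable (fun x => j x / order_param n x) kappa 1) ->
        0 < eps ->
        (forall rho : R,
          (rho_c n j - eps%:E < rho%:E < rho_c n j)%E \/
          (rho_c n j < rho%:E < rho_c n j + eps%:E)%E ->
          forall kappa, pos_solutions n nu tau j rho kappa ->
            derive1 (fun x => j x / order_param n x) kappa != 0) ->
        forall (rho : R) (m : nat),
          pos_solutions n nu tau j rho #= `I_m ->
          ((rho_c n j - eps%:E < rho%:E < rho_c n j)%E -> ~~ odd m) /\
          ((rho_c n j < rho%:E < rho_c n j + eps%:E)%E -> odd m)] /\
  (forall rho : R, 0 < rho ->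
     pos_solutions n nu tau j rho #= noniso_families mu nu tau rho).
Proof.
have [l [H1 H2 H3 l0]] := rho_c_cvg hcoef hn.
have lE : rho_c n j = l by rewrite /rho_c; exact: (cvg_lim (@ereal_hausdorff R) H1).
rewrite lE; split.
  by split; [exact: H1|exact: H2|exact: H3|exact: l0|exact: (rho_starE hcoef)].
split; first exact: (rho_star_le_rho_c hcoef H2).
split; last exact: (noniso_families_card hn hcoef hmu).
split.
- move=> rho rho0 rhoS; have sol0 := solutions_below_rho_star hcoef hn rhoS.
  split=> // f; have [Om0 SOm0] := usphere_nonempty (R := R) hn; split=> [[eqf mf]|fE].
    have [kappa [Om [kp SOm kE fE]]] :=
      equilibrium_vonMises hn hmu (tau_gt0 hcoef) (nu_ge0 hcoef) (kfun0 hcoef) rho0 eqf mf.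
    (* A positive parameter would solve the compatibility equation, whose only solution here is
       0. *)
    have kap0 : kappa = 0.
      apply/eqP; rewrite eq_le kp andbT leNgt; apply/negP => kap_gt0.
      have [sk _] := (pos_solutions_fixpoint hn hcoef rho0 kap_gt0).2 kE.
      by move: sk; rewrite sol0 /= => kap0; rewrite kap0 ltxx in kap_gt0.
    by move=> w Sw; rewrite fE// kap0 vonMises_isotropic.
  have k00 : 0 = kfun nu tau (rho * order_param n 0).
    by rewrite (order_param0 hn) mulr0 (kfun0 hcoef).
  apply: (vonMises_equilibrium hn hmu (tau_gt0 hcoef) rho0 (lexx 0) SOm0 k00) => w Sw.
  by rewrite fE// vonMises_isotropic.
- move=> rho rho0 rhoS; split; first exact: (pos_solutions_above_rho_star hcoef hn).
  by move=> kappa sk; exact: (vonMises_family_noniso hn hcoef hmu).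
- move=> eps _ dF eps0 F'0 rho m cardm; split=> rhoI.
    have [_ rhol] := andP rhoI.
    (* Since rho lies below the limit rho_c of j/c at 0, the quotient starts above rho. *)
    have nearF : \forall kappa \near 0^'+, j kappa / order_param n kappa != rho /\
        (rho < j kappa / order_param n kappa) = true.
      have : \forall kappa \near 0^'+, (rho%:E < (j kappa / order_param n kappa)%:E)%E.
        exact: (H1 _ (open_ereal_gt' rhol)).
      by apply: filterS => kappa /=; rewrite lte_fin => rhoF; rewrite rhoF gt_eqF.
    by rewrite (pos_solutions_parity hn hcoef nearF dF (F'0 rho (or_introl rhoI)) cardm).
  have [lrho _] := andP rhoI.
  (* Now rho lies above rho_c, so the quotient starts below rho and has to cross an odd number of
     times. *)
  have nearF : \forall kappa \near 0^'+, j kappa / order_param n kappa != rho /\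
      (rho < j kappa / order_param n kappa) = false.
    have : \forall kappa \near 0^'+, ((j kappa / order_param n kappa)%:E < rho%:E)%E.
      exact: (H1 _ (open_ereal_lt' lrho)).
    apply: filterS => kappa /=; rewrite lte_fin => rhoF.
    by rewrite lt_eqF//; split=> //; apply/negbTE; rewrite -leNgt ltW.
  by rewrite (pos_solutions_parity hn hcoef nearF dF (F'0 rho (or_intror rhoI)) cardm).
Qed.
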